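(* Let $p>3$ be a prime. Then $$\sum_{k=0}^{p-1}\binom{-\frac14}k^24^k\equiv\frac{3-(-1)^{\frac{p-1}2}}2\Big(\frac2p\Big)\sum_{k=0}^{p-1}\binom{-\frac14}k^2\frac1{4^k}\equiv\begin{cases}(-1)^{\frac{p-1}4+\frac{A-1}2}2A\pmod p&\text{if }p=A^2+3B^2\equiv1\pmod{12},\\(-1)^{\frac{p+1}4}6B\pmod p&\text{if }p=A^2+3B^2\equiv7\pmod{12},\ 4\mid B-1,\\0\pmod p&\text{if }p\equiv2\pmod3,\end{cases}$$ where $A,B\in\mathbb Z$.
   Context: For rational $a$, $\binom ak=a(a-1)\cdots(a-k+1)/k!$. $\big(\frac2p\big)$ is the Legendre symbol. Congruences mod $p$ are among rationals with denominator coprime to $p$. *)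

(* Defs.v *)
From HB Require Import structures.
From mathcomp Require Import all_boot all_order all_algebra.

Set Implicit Arguments.
Unset Strict Implicit.
Unset Printing Implicit Defensive.

Import Order.TTheory GRing.Theory Num.Theory.

Local Open Scope ring_scope.

Definition qbin (a : rat) (k : nat) : rat :=
  (\prod_(i < k) (a - i%:R)) / (k`!)%:R.

(* Only meant for an odd prime p. *)
Definition legendre (a : int) (p : nat) : int :=
  if (p %| a)%Z then 0
  else if [exists x : 'I_p, ((x : nat)%:Z ^+ 2 == a %[mod p])%Z] then 1
  else -1.

Definition qint_at (p : nat) (x : rat) : bool := coprimez (denq x) p.

(* The integrality of both sides is part of the congruence. *)
Definition qcong (p : nat) (x y : rat) : Prop :=
  [/\ qint_at p x, qint_at p y & (p %| numq (x - y))%Z].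

(* Main.v *)
Require Import Defs.
From HB Require Import structures.
From mathcomp Require Import all_boot all_order all_algebra.
From mathcomp Require Import all_solvable all_field.
From mathcomp Require Import zify ring.

Set Implicit Arguments.
Unset Strict Implicit.
Unset Printing Implicit Defensive.

Import Order.TTheory GRing.Theory Num.Theory.

Local Open Scope ring_scope.

(* Work in F_p. Choose n < p with 4n = -1 mod p, so that binom(-1/4, k) = C(n, k),
   and let h = (p-1)/2, chi the quadratic character. Extracting the coefficient
   of t^n in (1+t)^n (1+4t)^n gives
     sum_k C(n,k)^2 4^k = sum_k C(n,k) C(n+k,k) 4^k (-3)^(n-k),
   and C(n,k) C(n+k,k) (-4)^k = C(h,2k) C(2k,k), so up to powers of -3 the sum is
   the coefficient of x^(p-1) in (x^3+3x^2+3x)^h = ((x+1)^3-1)^h, that is, the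
   character sum f = sum_x chi(x^3+1) of the curve y^2 = x^3+1.
   If p = 2 mod 3, cubing is a bijection and f = 0.  If p = 1 mod 3, the first two
   moments of a |-> sum_x chi(x^3+a) over the three cubic classes show f = 2A'
   with p = A'^2 + 3B'^2 and A' = -1 mod 3, so A' = +-A.
   Since -3 = (A/B)^2 in F_p, the remaining power of -3 is, up to a factor A/B,
   equal to chi(A) chi(B), which quadratic reciprocity evaluates.
   The second equality of the theorem is the symmetry k -> n-k together with
   4^n = (3-(-1)^h)/2 (2/p). *)

(** * Power sums and the quadratic character of a finite field *)

Lemma card_finField_gt1 (F : finFieldType) : (1 < #|F|)%N.
Proof. exact: finNzRing_gt1. Qed.

Lemma expf_card_pred (F : finFieldType) (x : F) : x != 0 -> x ^+ #|F|.-1 = 1.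
Proof.
move=> x0; apply: (mulfI x0); rewrite -exprS prednK ?expf_card ?mulr1 //.
exact: ltnW (finNzRing_gt1 F).
Qed.

Lemma card_nz (F : finFieldType) : #|[pred x : F | x != 0]| = #|F|.-1.
Proof. by rewrite -(cardC1 (0 : F)); apply: eq_card. Qed.

Lemma finField_prim_root (F : finFieldType) :
  exists z : F, (#|F|.-1).-primitive_root z.
Proof.
have qgt1 : (1 < #|F|)%N := card_finField_gt1 F.
have /hasP[z _ hz] : has (#|F|.-1).-primitive_root (enum [pred x : F | x != 0]).
  apply: has_prim_root; rewrite ?enum_uniq -?cardE ?card_nz //; first by
    rewrite -ltnS prednK // ltnW.
  apply/allP => x; rewrite mem_enum inE => x0; apply/unity_rootP.
  by rewrite expf_card_pred.
by exists z.
Qed.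

(** Translation by 1 permutes F, so the sum of all elements does not change when [#|F|] is added to
    it. *)
Lemma natr_card_finField (F : finFieldType) : #|F|%:R = 0 :> F.
Proof.
have : \sum_(x : F) (x + 1) = \sum_(x : F) x.
  by rewrite [RHS](reindex_inj (addIr 1)).
rewrite big_split /= sumr_const => /eqP.
by rewrite -subr_eq0 addrAC subrr add0r => /eqP.
Qed.

(** Scaling by a primitive root z multiplies the sum by z^k, so it vanishes unless z^k = 1; in that
    case every term is 1. *)
Lemma sum_nz_expr (F : finFieldType) (k : nat) :
  \sum_(x : F | x != 0) x ^+ k = if (#|F|.-1 %| k)%N then - 1 else 0.
Proof.
have [z hz] := finField_prim_root F.
have z0 : z != 0.
  by rewrite (prim_root_eq0 hz); have := prim_order_gt0 hz; lia.
have h : z ^+ k * \sum_(x : F | x != 0) x ^+ k = \sum_(x : F | x != 0) x ^+ k.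
  rewrite [RHS](reindex_inj (mulfI z0)) /= mulr_sumr.
  apply: eq_big => [x|x _]; first by rewrite mulf_eq0 (negPf z0).
  by rewrite exprMn.
case: ifP => [/dvdnP[m ->] | /negbT].
- rewrite (eq_bigr (fun=> 1)) => [|x x0]; last by rewrite mulnC exprM expf_card_pred ?expr1n.
  rewrite sumr_const card_nz -subn1 natrB ?natr_card_finField ?sub0r //.
  by have := card_finField_gt1 F; lia.
- rewrite (prim_order_dvd hz) => /negPf zk1.
  move/eqP: h; rewrite -subr_eq0 -{2}[\sum_(_ | _) _]mul1r -mulrBl mulf_eq0 subr_eq0.
  by rewrite zk1 => /eqP.
Qed.

(** Below degree 2(q-1) only the exponents 0 and q-1 have a nonzero power sum, and the contribution
    of exponent 0 cancels P(0). *)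
Lemma sum_horner (F : finFieldType) (P : {poly F}) :
  (size P <= (#|F|.-1).*2)%N -> \sum_x P.[x] = - P`_(#|F|.-1).
Proof.
have qgt1 : (1 < #|F|)%N := card_finField_gt1 F.
move=> sP; rewrite (bigD1 0) //= horner_coef0.
have -> : \sum_(x : F | x != 0) P.[x] =
          \sum_(i < (#|F|.-1).*2) P`_i * \sum_(x : F | x != 0) x ^+ i.
  rewrite (eq_bigr _ (fun x _ => horner_coef_wide x sP)) exchange_big /=.
  by apply: eq_bigr => i _; rewrite mulr_sumr.
have q0 : (0 < #|F|.-1)%N by lia.
have h0 : (0 < (#|F|.-1).*2)%N by lia.
have h1 : (#|F|.-1 < (#|F|.-1).*2)%N by lia.
rewrite (bigD1 (Ordinal h0)) // (bigD1 (Ordinal h1)) /=; last by rewrite -val_eqE /= -lt0n.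
rewrite [X in _ + (_ + (_ + X))]big1; last first.
  move=> i /andP[i0 i1].
  rewrite sum_nz_expr; case: ifP; rewrite ?mulr0 // => /dvdnP[m hm].
  have : (m * #|F|.-1 < 2 * #|F|.-1)%N by rewrite -hm mul2n ltn_ord.
  rewrite ltn_pmul2r //.
  case: m hm => [|[|m]] //; rewrite ?mul1n => hm.
    by move: i0; rewrite -val_eqE /= hm.
  by move: i1; rewrite -val_eqE /= hm eqxx.
by rewrite !sum_nz_expr dvdn0 dvdnn !mulrN1 addr0 addrA addrN add0r.
Qed.

(** Euler's criterion is taken as the definition. The values are integers, so that characters of
    different fields can be compared and summed. *)
Definition qchar (F : finFieldType) (x : F) : int :=
  if x == 0 then 0 else if x ^+ (#|F|.-1)./2 == 1 then 1 else -1.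

Section QChar.
Variable F : finFieldType.
Hypothesis oddF : odd #|F|.
Implicit Types x y : F.
Local Notation chi := (@qchar F).

Let card_double : #|F|.-1 = ((#|F|.-1)./2 * 2)%N.
Proof. by move: oddF; lia. Qed.

Let half_gt0 : (0 < (#|F|.-1)./2)%N.
Proof. by have := card_finField_gt1 F; move: oddF; lia. Qed.

Lemma natr2_neq0 : 2 != 0 :> F.
Proof.
have : #|F|%:R = 1 + 2 * (#|F|./2)%:R :> F.
  by rewrite -natrM -[1]/(1%:R) -natrD; congr (_%:R); move: oddF; lia.
rewrite natr_card_finField => h; apply/eqP => h2.
by move/eqP: h; rewrite h2 mul0r addr0 eq_sym oner_eq0.
Qed.

Lemma oner_neqN1 : 1 != -1 :> F.
Proof. by rewrite -subr_eq0 opprK natr2_neq0. Qed.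

Lemma qcharE x : (chi x)%:~R = x ^+ (#|F|.-1)./2.
Proof.
rewrite /qchar; case: eqP => [->|/eqP x0]; first by rewrite expr0n gtn_eqF.
case: eqP => [->//|/eqP h].
have : (x ^+ (#|F|.-1)./2) ^+ 2 == 1.
  by rewrite -exprM -card_double expf_card_pred.
by rewrite sqrf_eq1 (negPf h) /= => /eqP ->.
Qed.

Lemma qcharP x : [\/ chi x = 0, chi x = 1 | chi x = -1].
Proof.
by rewrite /qchar; case: ifP => _; [apply: Or31|case: ifP => _; [apply: Or32|apply: Or33]].
Qed.

(** In odd characteristic 0, 1 and -1 remain distinct, so identities between characters can be
    checked in F, where [chi] is a power. *)
Lemma qchar_inj (a b : int) :
  [\/ a = 0, a = 1 | a = -1] -> [\/ b = 0, b = 1 | b = -1] ->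
  a%:~R = b%:~R :> F -> a = b.
Proof.
have n1 := oner_neqN1; have n0 := oner_neq0 F.
by case=> ->; case=> ->; rewrite // ?mulrN1z ?mulr1z ?mulr0z => /eqP h; exfalso;
  move: h; apply/negP; rewrite // ?oppr_eq0 // eq_sym ?oppr_eq0.
Qed.

Lemma qcharM x y : chi (x * y) = chi x * chi y.
Proof.
apply: qchar_inj; first exact: qcharP.
  by case: (qcharP x) => ->; case: (qcharP y) => ->;
    rewrite ?mulr0 ?mul0r ?mulr1 ?mulrN1; constructor.
by rewrite intrM !qcharE exprMn.
Qed.

Lemma qchar0 : chi 0 = 0. Proof. by rewrite /qchar eqxx. Qed.

Lemma qchar1 : chi 1 = 1.
Proof. by rewrite /qchar oner_eq0 expr1n eqxx. Qed.

Lemma qchar_sqr x : x != 0 -> chi x * chi x = 1.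
Proof. by move=> x0; rewrite /qchar (negPf x0); case: ifP. Qed.

Lemma qchar_eq0 x : (chi x == 0) = (x == 0).
Proof. by rewrite /qchar; case: (x =P 0) => // _; case: ifP. Qed.

Lemma qcharX x n : chi (x ^+ n) = chi x ^+ n.
Proof.
by elim: n => [|n IH]; rewrite ?qchar1 // !exprS qcharM IH.
Qed.

Lemma qcharV x : chi x^-1 = chi x.
Proof.
have [->|x0] := eqVneq x 0; first by rewrite invr0.
by rewrite -[RHS]mulr1 -(qchar_sqr (invr_neq0 x0)) mulrA -qcharM mulfV ?qchar1 ?mul1r.
Qed.

Lemma qchar_nonresidue : exists z : F, chi z = -1.
Proof.
have [z hz] := finField_prim_root F; exists z.
rewrite /qchar (prim_root_eq0 hz) -(prim_order_dvd hz).
have := prim_order_gt0 hz; case: eqP => [->//|_] q0.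
case: ifP => // /(dvdn_leq half_gt0); move: half_gt0 card_double; lia.
Qed.

Lemma qchar1_sqrt x : chi x = 1 -> exists y, x = y ^+ 2.
Proof.
have [z hz] := finField_prim_root F; rewrite /qchar.
case: eqP => // /eqP x0; case: eqP => // hx _.
have [[i lti] /= xE] := prim_rootP hz (expf_card_pred x0).
move/eqP: hx; rewrite xE -exprM -(prim_order_dvd hz) [X in (X %| _)%N]card_double mulnC.
by rewrite dvdn_pmul2r // => /dvdnP[k ->]; exists (z ^+ k); rewrite exprM.
Qed.

Lemma sum_qchar : \sum_x chi x = 0.
Proof.
have [z hz] := qchar_nonresidue.
have z0 : z != 0 by rewrite -qchar_eq0 hz.
have h : \sum_x chi x = - \sum_x chi x.
  rewrite {1}(reindex_inj (mulfI z0)) /= -sumrN.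
  by apply: eq_bigr => x _; rewrite qcharM hz mulN1r.
by lia.
Qed.

(** For a nonzero, replacing a by 1/a turns the summand into chi(1 + b a); what remains is the full
    sum of chi, which is 0, minus chi(1). *)
Lemma sum_qchar_shift b : b != 0 -> \sum_a chi a * chi (a + b) = -1.
Proof.
move=> b0; rewrite (bigD1 0) //= qchar0 mul0r add0r.
transitivity (\sum_(a : F | a != 0) chi (1 + b * a)).
  rewrite (reindex_inj invr_inj) /=; apply: eq_big => [a|a]; rewrite invr_eq0 // => a0.
  rewrite qcharV -qcharM; congr chi; field; exact: a0.
have := sum_qchar; rewrite (reindex_inj (addrI 1)) (reindex_inj (mulfI b0)) /=.
by rewrite (bigD1 0) //= mulr0 addr0 qchar1 addrC => /eqP; rewrite addr_eq0 => /eqP.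
Qed.

Lemma sum_qchar_corr b c : \sum_a chi (a + b) * chi (a + c) = (b == c)%:Z * #|F|%:Z - 1.
Proof.
transitivity (\sum_a chi a * chi (a + (c - b))).
  rewrite [RHS](reindex_inj (addIr b)) /=.
  by apply: eq_bigr => a _; congr (_ * chi _); ring.
case: eqP => [<-|/eqP bc]; last by rewrite sum_qchar_shift ?mul0r // subr_eq0 eq_sym.
rewrite (bigD1 0) //= qchar0 mul0r add0r (eq_bigr (fun=> 1)) => [|a a0].
  by rewrite sumr_const card_nz natz mul1r -subn1 -subzn // ltnW ?card_finField_gt1.
by rewrite subrr addr0 qchar_sqr.
Qed.

End QChar.

(** * The cubic sums *)

Lemma sum_nz_prim (F : finFieldType) (z : F) (V : zmodType) (H : F -> V) :
  (#|F|.-1).-primitive_root z ->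
  \sum_(x : F | x != 0) H x = \sum_(0 <= i < #|F|.-1) H (z ^+ i).
Proof.
move=> hz; have z0 : z != 0.
  by rewrite (prim_root_eq0 hz) -lt0n; exact: prim_order_gt0 hz.
rewrite -[RHS](big_map (fun i => z ^+ i) predT).
rewrite -[LHS]big_filter; apply: perm_big; apply: uniq_perm.
- by rewrite filter_uniq // index_enum_uniq.
- rewrite map_inj_in_uniq ?iota_uniq // => i j; rewrite !mem_index_iota /= => hi hj /eqP.
  by rewrite (eq_prim_root_expr hz) !modn_small // => /eqP.
- move=> x; rewrite mem_filter mem_index_enum andbT; apply/idP/mapP => [x0|[i _ ->]].
    have [[i lti] /= xE] := prim_rootP hz (expf_card_pred x0).
    by exists i; rewrite // mem_index_iota.
  exact: expf_neq0.
Qed.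

Lemma sumz_const (I : finType) (P : pred I) (c : int) :
  \sum_(i | P i) c = c * #|P|%:Z.
Proof. by rewrite sumr_const pmulrn mulrzz. Qed.

Lemma big_nat_mul3 (V : zmodType) (G : nat -> V) (M : nat) :
  \sum_(0 <= i < 3 * M) G i =
  \sum_(0 <= i < M) (G (3 * i)%N + G (3 * i).+1 + G (3 * i).+2).
Proof.
elim: M => [|M IH]; first by rewrite muln0 !big_geq.
by rewrite mulnS addnC addn3 !big_nat_recr //= IH !addrA.
Qed.

Lemma big_nat_period (V : zmodType) (G : nat -> V) (M k : nat) :
  (forall i, G (M + i)%N = G i) ->
  \sum_(0 <= i < M * k) G i = (\sum_(0 <= i < M) G i) *+ k.
Proof.
move=> per; elim: k => [|k IH]; first by rewrite muln0 big_geq.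
rewrite mulnS (@big_cat_nat _ _ _ M) ?leq_addr //= mulrS -IH; congr (_ + _).
rewrite -{1}[M]add0n big_addn addKn; apply: eq_bigr => i _.
by rewrite addnC.
Qed.

Section CubicSums.
Variable F : finFieldType.
Hypothesis oddF : odd #|F|.
Hypothesis card_mod3 : (3 %| #|F|.-1)%N.
Local Notation chi := (@qchar F).
Variable z : F.
Hypothesis hz : (#|F|.-1).-primitive_root z.

Let z0 : z != 0.
Proof. by rewrite (prim_root_eq0 hz) -lt0n; exact: prim_order_gt0 hz. Qed.

(** Cubing is three-to-one on nonzero elements: the exponents 3i modulo q-1 have period (q-1)/3 in
    i. *)
Lemma sum_cube (V : zmodType) (H : F -> V) :
  \sum_(x : F | x != 0) H (x ^+ 3) =
  (\sum_(0 <= i < #|F|.-1 %/ 3) H (z ^+ (3 * i))) *+ 3.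
Proof.
rewrite (sum_nz_prim (fun x => H (x ^+ 3)) hz).
have [M qM] := dvdnP card_mod3.
have zM : z ^+ (3 * M) = 1 by rewrite mulnC -qM prim_expr_order.
have h i : H ((z ^+ (M + i)) ^+ 3) = H ((z ^+ i) ^+ 3).
  by rewrite -!exprM mulnDl [(M * 3)%N]mulnC exprD zM mul1r.
rewrite qM mulnK // big_nat_period //; congr (_ *+ _).
by apply: eq_bigr => i _; rewrite -exprM mulnC.
Qed.

Lemma sum_cube_cosets (H : F -> int) :
  3 * \sum_(x : F | x != 0) H x =
  \sum_(x : F | x != 0) (H (x ^+ 3) + H (z * x ^+ 3) + H (z ^+ 2 * x ^+ 3)).
Proof.
rewrite (sum_cube (fun y => H y + H (z * y) + H (z ^+ 2 * y))).
rewrite (sum_nz_prim _ hz) -[X in index_iota 0 X](divnK card_mod3) mulnC big_nat_mul3.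
rewrite mulr_natl; congr (_ *+ _); apply: eq_bigr => i _.
by rewrite -exprS -exprD.
Qed.

(** The curve y^2 = x^3 + a has q + [cubsum a] affine points. *)
Definition cubsum (a : F) : int := \sum_x chi (x ^+ 3 + a).

(** Substituting t x for x pulls out chi(t^3) = chi(t). Up to sign, [cubsum] thus depends only on
    the class of a modulo cubes. *)
Lemma cubsum_scale a t : t != 0 -> cubsum (a * t ^+ 3) = chi t * cubsum a.
Proof.
move=> t0; rewrite /cubsum (reindex_inj (mulfI t0)) mulr_sumr /=.
apply: eq_bigr => x _.
have -> : (t * x) ^+ 3 + a * t ^+ 3 = t ^+ 3 * (x ^+ 3 + a) by ring.
by rewrite qcharM // qcharX // !exprS expr0 mulr1 qchar_sqr // mulr1.
Qed.

Lemma sum_eq_cube (c : F) : c != 0 -> \sum_x (x ^+ 3 == c ^+ 3)%:Z = 3.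
Proof.
move=> c0; rewrite (reindex_inj (mulfI c0)) (bigD1 0) //= mulr0 expr0n /=.
rewrite eq_sym expf_eq0 (negPf c0) andbF add0r.
rewrite (eq_bigr (fun x => (x ^+ 3 == 1)%:Z)) => [|x _]; last first.
  by rewrite exprMn -{2}[c ^+ 3]mulr1 (inj_eq (mulfI _)) ?expf_neq0.
rewrite (sum_cube (fun y => (y == 1)%:Z)).
have M0 : (0 < #|F|.-1 %/ 3)%N.
  by rewrite divn_gt0 // dvdn_leq // (prim_order_gt0 hz).
rewrite big_ltn // muln0 expr0 eqxx big_nat big1 ?addr0 // => i /andP[i0 iM].
rewrite -(prim_order_dvd hz) -{1}(divnK card_mod3) mulnC dvdn_pmul2l //.
by rewrite gtnNdvd.
Qed.

Lemma cubsum0 : cubsum 0 = 0.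
Proof.
rewrite /cubsum -[RHS](sum_qchar oddF); apply: eq_bigr => x _.
rewrite addr0 qcharX //; have [->|x0] := eqVneq x 0; first by rewrite qchar0.
by rewrite !exprS expr0 mulr1 qchar_sqr // mulr1.
Qed.

(** The product chi(a) * cubsum(a) is constant on each class modulo cubes, so its sum over all a is
    a multiple of the left side. By orthogonality of the translates of chi that sum is q - q = 0. *)
Lemma cubsum_moment1 : cubsum 1 + chi z * cubsum z + cubsum (z ^+ 2) = 0.
Proof.
have M1 : \sum_(a : F | a != 0) chi a * cubsum a = 0.
  transitivity (\sum_a chi a * cubsum a).
    by rewrite [RHS](bigD1 0) //= qchar0 mul0r add0r.
  under eq_bigr do rewrite mulr_sumr.
  rewrite exchange_big /= (eq_bigr (fun x => (x == 0)%:Z * #|F|%:Z - 1)) => [|x _].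
    rewrite sumrB (bigD1 0) //= eqxx mul1r big1 => [|x /negPf ->]; last by rewrite mul0r.
    by rewrite addr0 sumz_const mul1r subrr.
  under eq_bigr => a _ do rewrite -{1}[a]addr0 [_ + a]addrC.
  by rewrite sum_qchar_corr // eq_sym expf_eq0.
have := sum_cube_cosets (fun a => chi a * cubsum a).
rewrite M1 mulr0 (eq_bigr (fun=> cubsum 1 + chi z * cubsum z + cubsum (z ^+ 2))) => [|x x0].
  rewrite sumr_const card_nz => /esym/eqP; rewrite mulrn_eq0 eqn0Ngt.
  by rewrite (prim_order_gt0 hz) => /eqP.
have hx : chi x * chi x = 1 by rewrite qchar_sqr.
have hc a : chi (a * x ^+ 3) * cubsum (a * x ^+ 3) = chi a * cubsum a.
  rewrite cubsum_scale // (qcharM oddF a) [chi (x ^+ 3)]qcharX // !exprS expr0 mulr1 hx mulr1.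
  by rewrite mulrA -[_ * _ * chi x]mulrA hx mulr1.
rewrite hc hc -{1 2}[x ^+ 3]mul1r hc qchar1 // mul1r qcharX //.
by rewrite expr2 qchar_sqr // mul1r.
Qed.

Lemma cubsum_moment2 :
  cubsum 1 ^+ 2 + cubsum z ^+ 2 + cubsum (z ^+ 2) ^+ 2 = 6 * #|F|%:Z.
Proof.
have q1 := card_finField_gt1 F.
have M2 : \sum_(a : F | a != 0) cubsum a ^+ 2 = 2 * #|F|%:Z * #|F|.-1%:Z.
  transitivity (\sum_a cubsum a ^+ 2).
    by rewrite [RHS](bigD1 0) //= cubsum0 expr0n add0r.
  (* Expand the square and sum over a first. There are 1 + 3(q-1) pairs with equal cubes, which
     gives q(3q-2) - q^2 = 2q(q-1). *)
  transitivity (\sum_(x : F) \sum_(y : F) ((y ^+ 3 == x ^+ 3)%:Z * #|F|%:Z - 1)).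
    under eq_bigr do rewrite expr2 mulr_suml; rewrite exchange_big /=.
    apply: eq_bigr => x _; under eq_bigr do rewrite mulr_sumr; rewrite exchange_big /=.
    apply: eq_bigr => y _; rewrite eq_sym -sum_qchar_corr //.
    by apply: eq_bigr => a _; rewrite ![_ + a]addrC.
  under eq_bigr do rewrite sumrB sumz_const -mulr_suml.
  rewrite sumrB sumz_const -mulr_suml (bigD1 0) //=.
  rewrite [X in (X + _) * _](_ : _ = 1); last first.
    by rewrite (bigD1 0) //= eqxx big1 ?addr0 // => y y0; rewrite expr0n expf_eq0 (negPf y0).
  rewrite [X in (_ + X) * _](_ : _ = 3 * #|F|.-1%:Z); last first.
    transitivity (\sum_(x : F | x != 0) (3 : int)).
      by apply: eq_bigr => x x0; exact: sum_eq_cube.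
    by rewrite sumz_const card_nz.
  have -> : #|F|%:Z = #|F|.-1%:Z + 1 by rewrite -[in LHS](prednK (ltnW q1)) intS addrC.
  ring.
have := sum_cube_cosets (fun a => cubsum a ^+ 2).
rewrite M2 (eq_bigr (fun=> cubsum 1 ^+ 2 + cubsum z ^+ 2 + cubsum (z ^+ 2) ^+ 2)) => [|x x0].
  rewrite sumz_const card_nz !mulrA => h; apply/esym.
  have q0 : #|F|.-1%:Z != 0 by rewrite eqz_nat -lt0n (prim_order_gt0 hz).
  by apply: (mulIf q0); rewrite -h.
by rewrite -{1}[x ^+ 3]mul1r !cubsum_scale // !exprMn expr2 qchar_sqr // !mul1r.
Qed.

(** The term x = 0 is chi(1) = 1, and the nonzero x fall into triples with a common cube. *)
Lemma cubsum1_mod3 : (3 %| cubsum 1%R - 1)%Z.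
Proof.
rewrite /cubsum (bigD1 0) //= expr0n add0r qchar1 (sum_cube (fun y => chi (y + 1))).
by rewrite addrAC subrr add0r pmulrn mulrzz dvdz_mull.
Qed.

(** Three terms vanish, at the roots of x^3 = -1; the other q - 3 are signs, and q - 3 is even. *)
Lemma cubsum1_even : (2 %| cubsum 1%R)%Z.
Proof.
have h : \sum_x chi (x ^+ 3 + 1) ^+ 2 = #|F|%:Z - 3.
  rewrite -(sum_eq_cube (_ : -1 != 0)) ?oppr_eq0 ?oner_eq0 //.
  rewrite -[#|F|%:Z]mul1r -sumz_const -sumrB; apply: eq_bigr => x _.
  rewrite (_ : (-1) ^+ 3 = -1); last by ring.
  rewrite -addr_eq0.
  have [->|x0] := eqVneq (x ^+ 3 + 1) 0; first by rewrite qchar0 expr0n subrr.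
  by rewrite expr2 qchar_sqr.
have h2 : cubsum 1 = #|F|%:Z - 3 - 2 * \sum_x (chi (x ^+ 3 + 1) == -1)%:Z.
  rewrite -h mulr_sumr -sumrB; apply: eq_bigr => x _.
  by case: (qcharP (x ^+ 3 + 1)) => ->.
rewrite h2; move: oddF; lia.
Qed.

Lemma cubsum1_norm : exists A B : int,
  [/\ cubsum 1 = 2 * A, #|F|%:Z = A ^+ 2 + 3 * B ^+ 2 & (3 %| A + 1)%Z].
Proof.
have /dvdzP[A fA] := cubsum1_even; have /dvdzP[K fK] := cubsum1_mod3.
have m1 := cubsum_moment1; have m2 := cubsum_moment2.
have m2' : cubsum 1 ^+ 2 + (chi z * cubsum z) ^+ 2 + cubsum (z ^+ 2) ^+ 2 = 6 * #|F|%:Z.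
  by rewrite exprMn [chi z ^+ 2]expr2 qchar_sqr // mul1r.
move: m1 m2'; set F1 := chi z * _; set F2 := cubsum (_ ^+ 2) => m1 m2'.
have e2 : F2 = - (A * 2) - F1 by move: m1; rewrite fA; clear; lia.
(* Eliminating the third class sum with the first moment turns the second moment into this square.
   It is divisible by 3, so F1 + A = 3B, and B is the second coordinate of the norm form. *)
have e3 : (F1 + A) ^+ 2 = 3 * (#|F|%:Z - A ^+ 2).
  move: m2'; rewrite fA e2 => m; apply: (mulfI (_ : 2 != 0)) => //.
  have -> : 2 * (3 * (#|F|%:Z - A ^+ 2)) = 6 * #|F|%:Z - 6 * A ^+ 2 by ring.
  by rewrite -m; ring.
have /dvdzP[B FB] : (3 %| F1 + A)%Z.
  have : (3 %| (F1 + A) ^+ 2)%Z by rewrite e3 dvdz_mulr.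
  by rewrite !dvdzE abszX Euclid_dvdX // andbT.
exists A, B; split; [by rewrite fA mulrC | | by move: fK; rewrite fA; clear; lia].
apply: (mulfI (_ : 3 != 0)) => //.
have -> : 3 * #|F|%:Z = 3 * (#|F|%:Z - A ^+ 2) + 3 * A ^+ 2 by ring.
by rewrite -e3 FB; ring.
Qed.

End CubicSums.

(** * Quadratic reciprocity *)

(** By Euler's theorem m divides p^(totient m) - 1, the order of the multiplicative group of the
    field with p^(totient m) elements. *)
Lemma exists_prim_root_pchar (p m : nat) :
  prime p -> coprime p m -> (0 < m)%N ->
  exists (F : finFieldType) (w : F), p \in [pchar F] /\ m.-primitive_root w.
Proof.
move=> pp cop m0; have t0 : (0 < totient m)%N by rewrite totient_gt0.
have [F pF cF] := pPrimePowerField pp t0.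
have [z hz] := finField_prim_root F.
exists F, (z ^+ (#|F|.-1 %/ m)); split=> //; apply: dvdn_prim_root => //.
rewrite cF -subn1 -eqn_mod_dvd ?expn_gt0 ?prime_gt0 //.
by apply/eqP; exact: Euler_exp_totient.
Qed.

Lemma intr_eq0_pchar (R : nzRingType) (p : nat) (n : int) :
  p \in [pchar R] -> ((n%:~R == 0 :> R) = (p %| n)%Z).
Proof.
by move=> pR; case: n => n; rewrite ?NegzE ?mulrNz ?oppr_eq0 dvdzE ?abszN -(dvdn_pcharf pR).
Qed.

(** For odd p the sign makes this integer congruent to 1 mod 4. *)
Definition pstar (p : nat) : int := (-1) ^+ (p.-1)./2 * p%:Z.

Section Reciprocity.
Variables p l : nat.
Hypotheses (pp : prime p) (pl : prime l) (oddp : odd p) (oddl : odd l).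
Hypothesis neq_pl : p != l.

Let oddFl : odd #|'F_l|. Proof. by rewrite card_Fp. Qed.
Let oddFp : odd #|'F_p|. Proof. by rewrite card_Fp. Qed.

Section GaussSum.
Variables (F : fieldType) (w : F).
Hypotheses (pF : p \in [pchar F]) (hw : l.-primitive_root w).
Implicit Types a b c : 'F_l.

(** An additive character of F_l with values in characteristic p. *)
Let e a : F := w ^+ (a : nat).

Let e_nat n : e n%:R = w ^+ n.
Proof. by rewrite /e val_Fp_nat // (prim_expr_mod hw). Qed.

Let eD a b : e (a + b) = e a * e b.
Proof. by rewrite -{1}[a]natr_Zp -{1}[b]natr_Zp -natrD e_nat exprD. Qed.

Let eM n a : e (n%:R * a) = e a ^+ n.
Proof. by rewrite -{1}[a]natr_Zp -natrM e_nat mulnC exprM. Qed.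

Let e0 : e 0 = 1. Proof. by []. Qed.

Let e_eq1 a : (e a == 1) = (a == 0).
Proof.
rewrite /e -(prim_order_dvd hw) -{2}[a]natr_Zp -(dvdn_pcharf (pchar_Fp pl)).
by [].
Qed.

Let sum_e c : \sum_a e (a * c) = if c == 0 then l%:R else 0.
Proof.
case: eqP => [->|/eqP c0].
  by under eq_bigr do rewrite mulr0 e0; rewrite sumr_const card_Fp.
have h : e c * (\sum_a e (a * c)) = \sum_a e (a * c).
  rewrite [RHS](reindex_inj (addrI 1)) mulr_sumr; apply: eq_bigr => a _ /=.
  by rewrite mulrDl mul1r eD.
move/eqP: h; rewrite -subr_eq0 -{2}[\sum_(_ | _) _]mul1r -mulrBl mulf_eq0 subr_eq0.
by rewrite e_eq1 (negPf c0) => /eqP.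
Qed.

(** The quadratic Gauss sum of F_l, formed in characteristic p. *)
Let g : F := \sum_a (qchar a)%:~R * e a.

Let gauss_sqr : g ^+ 2 = (pstar l)%:~R.
Proof.
(* The second index is written a * c, so that chi(a)^2 = 1 drops out for a nonzero. Summing over a
   then isolates c = -1, since the chi(c) sum to 0. *)
have h : g ^+ 2 = \sum_a \sum_c (qchar c)%:~R * ((a != 0)%:R * e (a * (1 + c))).
  rewrite expr2 mulr_suml; apply: eq_bigr => a _.
  rewrite mulr_sumr; have [->|a0] := eqVneq a 0.
    by rewrite !big1 // => c _; rewrite ?qchar0 ?mul0r ?mulr0.
  rewrite (reindex_inj (mulfI a0)); apply: eq_bigr => c _ /=.
  rewrite qcharM // mulrDr mulr1 eD intrM /= mul1r.
  have ha : (qchar a)%:~R * (qchar a)%:~R = 1 :> F by rewrite -intrM qchar_sqr.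
  have -> : forall x y u v : F, x * u * (x * y * v) = x * x * (y * (u * v)) by move=> *; ring.
  by rewrite ha mul1r.
rewrite h exchange_big /=.
have hc c : \sum_a (qchar c)%:~R * ((a != 0)%:R * e (a * (1 + c))) =
    (qchar c)%:~R * ((c == -1)%:R * l%:R) - (qchar c)%:~R.
  rewrite -mulr_sumr -[X in _ = _ - X]mulr1 -mulrBr; congr (_ * _).
  have := sum_e (1 + c); rewrite addrC addr_eq0 (bigD1 0) //= mul0r e0 => hs.
  rewrite (bigD1 0) //= mul0r add0r.
  rewrite (eq_bigr (fun a => e (a * (c + 1)))) => [|a a0]; last by rewrite a0 mul1r addrC.
  apply: (addrI 1); rewrite hs [RHS]addrC subrK.
  by case: (c == -1); rewrite ?mul1r ?mul0r.
rewrite (eq_bigr _ (fun c _ => hc c)) sumrB (bigD1 (-1)) //= eqxx mul1r.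
rewrite big1 => [|c /negPf ->]; last by rewrite mul0r mulr0.
have /(congr1 (fun x : int => x%:~R : F)) := sum_qchar oddFl.
rewrite rmorph_sum /= => ->; rewrite addr0 subr0 /pstar intrM; congr (_ * _); congr (_%:~R).
apply: (qchar_inj oddFl); [exact: qcharP | | ].
  by rewrite -signr_odd; case: odd; constructor.
by rewrite qcharE // card_Fp // rmorphXn /= rmorphN1.
Qed.

(** The Frobenius map sends e(a) to e(p a), and reindexing by p costs the factor chi(p). *)
Let gauss_frob : g ^+ p = (qchar (p%:R : 'F_l))%:~R * g.
Proof.
have p0 : (p%:R : 'F_l) != 0.
  by rewrite -(dvdn_pcharf (pchar_Fp pl)) dvdn_prime2 // eq_sym.
rewrite -(pFrobenius_autE pF) rmorph_sum /= [g](reindex_inj (mulfI p0)) /= mulr_sumr.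
apply: eq_bigr => a _; rewrite rmorphM /= rmorph_int pFrobenius_autE -eM.
by rewrite qcharM // intrM !mulrA -intrM qchar_sqr // mul1r.
Qed.

Lemma gauss_sum_pchar : (pstar l)%:~R ^+ (p.-1)./2 = (qchar (p%:R : 'F_l))%:~R :> F.
Proof.
have l0 : (l%:R : F) != 0.
  by rewrite -(dvdn_pcharf pF) dvdn_prime2.
have g0 : g != 0.
  apply/eqP => g0; have /esym/eqP := gauss_sqr; rewrite g0 expr0n; apply/negP.
  rewrite /pstar intrM mulf_neq0 //.
  by rewrite rmorphXn /= rmorphN1 expf_neq0 // oppr_eq0 oner_eq0.
apply: (mulIf g0); rewrite -gauss_frob -gauss_sqr -exprM -exprSr; congr (_ ^+ _).
by move: oddp; lia.
Qed.

End GaussSum.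

(** By Euler's criterion the left side is a power of [pstar l] mod p. This congruence of integers
    can be tested in any field of characteristic p, in particular in one that contains the Gauss
    sum. *)
Theorem quadratic_reciprocity :
  qchar ((pstar l)%:~R : 'F_p) = qchar (p%:R : 'F_l).
Proof.
have cop : coprime p l by rewrite prime_coprime // dvdn_prime2.
have [F [w [pF hw]]] := exists_prim_root_pchar pp cop (prime_gt0 pl).
apply: (qchar_inj oddFp); [exact: qcharP | exact: qcharP |].
rewrite qcharE // card_Fp //; apply/eqP; rewrite -subr_eq0 -rmorphXn -rmorphB /=.
rewrite (intr_eq0_pchar _ (pchar_Fp pp)) -(intr_eq0_pchar _ pF) rmorphB rmorphXn /=.
by rewrite (gauss_sum_pchar pF hw) subrr.
Qed.

End Reciprocity.

(** With w a primitive 8th root of unity in characteristic p, t = w + 1/w is a square root of 2. The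
    Frobenius map sends it to w^p + w^(-p), which is t or -t according to p mod 8. *)
Lemma qchar_2 (p : nat) : prime p -> odd p ->
  qchar (2 : 'F_p) = if (p %% 8 == 1)%N || (p %% 8 == 7)%N then 1 else -1.
Proof.
move=> pp oddp; have oddFp : odd #|'F_p| by rewrite card_Fp.
have cop : coprime p 8 by rewrite (_ : 8 = 2 ^ 3)%N // coprime_pexpr // coprimen2.
have [F [w [pF hw]]] := exists_prim_root_pchar pp cop isT.
have w8 := prim_expr_order hw.
have w4 : w ^+ 4 = -1.
  have : (w ^+ 4) ^+ 2 == 1 by rewrite -exprM w8.
  by rewrite sqrf_eq1 -(prim_order_dvd hw) /= => /eqP.
pose t := w + w ^+ 7.
have t2 : t ^+ 2 = 2.
  have -> : t ^+ 2 = w ^+ 2 + 2 * w ^+ 8 + w ^+ 2 * w ^+ 4 * w ^+ 8 by rewrite /t; ring.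
  by rewrite w4 w8; ring.
have t0 : t != 0.
  apply/eqP => t0; have /esym/eqP := t2; rewrite t0 expr0n /=.
  by rewrite -(dvdn_pcharf pF) dvdn_prime2 //; move: oddp; case: eqP => // ->.
pose s : int := if (p %% 8 == 1)%N || (p %% 8 == 7)%N then 1 else -1.
have tp : t ^+ p = s%:~R * t.
  rewrite -(pFrobenius_autE pF) rmorphD rmorphXn /= !pFrobenius_autE -exprM.
  rewrite -(prim_expr_mod hw p) -(prim_expr_mod hw (p * 7)) -modnMml /s.
  have : (p %% 8)%N \in [:: 1; 3; 5; 7]%N.
    by rewrite !inE; move: oddp; lia.
  rewrite !inE => /or4P[] /eqP -> /=; rewrite ?mulr1z ?mulrN1z /t.
  - by rewrite mul1r.
  - have -> : w ^+ (3 * 7 %% 8) = w * w ^+ 4 by rewrite -exprS.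
    have -> : w ^+ 7 = w ^+ 3 * w ^+ 4 by rewrite -exprD.
    by rewrite w4; ring.
  - have -> : w ^+ 5 = w * w ^+ 4 by rewrite -exprS.
    have -> : w ^+ 7 = w ^+ 3 * w ^+ 4 by rewrite -exprD.
    by rewrite w4; ring.
  - by rewrite mul1r addrC.
apply: (qchar_inj oddFp); [exact: qcharP | by case: ifP => _; constructor |].
rewrite qcharE // card_Fp // -/s; apply/eqP.
rewrite -subr_eq0 -[2]/((2 : int)%:~R) -rmorphXn -rmorphB /=.
rewrite (intr_eq0_pchar _ (pchar_Fp pp)) -(intr_eq0_pchar _ pF) rmorphB rmorphXn /=.
rewrite subr_eq0 (_ : 2%:~R = t ^+ 2); last by rewrite t2.
rewrite -exprM; apply/eqP; apply: (mulIf t0).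
by rewrite -tp -exprSr; congr (_ ^+ _); move: oddp; lia.
Qed.

Lemma qchar_N1 (p : nat) : prime p -> odd p ->
  qchar (-1 : 'F_p) = (-1) ^+ (p.-1)./2.
Proof.
move=> pp oddp; have oddFp : odd #|'F_p| by rewrite card_Fp.
apply: (qchar_inj oddFp); [exact: qcharP | | ].
  by rewrite -signr_odd; case: odd; constructor.
by rewrite qcharE // card_Fp // rmorphXn /= rmorphN1.
Qed.

(** * Quadratic characters of A and B when p = A^2 + 3B^2 *)

Lemma pstar_mod4 (l : nat) : odd l -> (4 %| pstar l - 1)%Z.
Proof.
rewrite /pstar -signr_odd => ol; case: (boolP (odd _)) => h; rewrite ?expr1 ?expr0 ?mulN1r ?mul1r;
  move: ol h; lia.
Qed.

Lemma abs_pstar (l : nat) : `|pstar l|%N = l.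
Proof. by rewrite /pstar abszM abszX /= exp1n mul1n. Qed.

(* An integer congruent to 1 mod 4 is exactly, sign included, a product of the
   signed primes [pstar l]. *)
Lemma pstar_morph_eq (f g : int -> int) (a : int) :
  f 1 = 1 -> g 1 = 1 -> {morph f : x y / x * y} -> {morph g : x y / x * y} ->
  (4 %| a - 1)%Z ->
  (forall l, prime l -> odd l -> (l %| `|a|)%N -> f (pstar l) = g (pstar l)) ->
  f a = g a.
Proof.
move=> f1 g1 fM gM; move: {2}(`|a|)%N (leqnn `|a|%N) => n.
elim: n a => [|n IH] a an a4 hl; first by move: an a4; lia.
have [a1|a1] := leqP `|a|%N 1; first by have -> : a = 1 by [move: a1 a4; lia]; rewrite f1.
pose l := pdiv `|a|%N.
have pl : prime l := pdiv_prime a1.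
have la : (l %| `|a|)%N := pdiv_dvd _.
have ol : odd l.
  have : odd `|a|%N by move: a4; lia.
  by move/dvdnP: la => [k ->]; rewrite oddM => /andP[].
have /dvdzP[b ab] : (pstar l %| a)%Z by rewrite dvdzE abs_pstar.
have l1 := prime_gt1 pl.
have abs_ab : `|a|%N = (`|b| * l)%N by rewrite ab abszM abs_pstar.
rewrite ab fM gM hl //; congr (_ * _); apply: IH.
- move: an a1; rewrite abs_ab; nia.
- have := pstar_mod4 ol; move: a4; rewrite ab; set c := pstar l.
  move=> /dvdzP[u hu] /dvdzP[v hv]; apply/dvdzP; exists (u - b * v).
  have -> : b - 1 = (b * c - 1) - b * (c - 1) by ring.
  by rewrite hu hv; ring.
- by move=> k pk ok kb; apply: hl => //; rewrite abs_ab dvdn_mulr.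
Qed.

(** Splitting off the sign and the power of 2 leaves a factor b to which [pstar_morph_eq]
    applies. *)
Lemma int_2adic (B : int) : B != 0 ->
  exists (s r : nat) (b : int),
    [/\ B = (-1) ^+ s * 2 ^+ r * b, B ^+ 2 = (2 ^+ r) ^+ 2 * b ^+ 2 & (4 %| b - 1)%Z].
Proof.
rewrite -absz_gt0 => B0.
have [m com mE] := pfactor_coprime (isT : prime 2) B0.
have om : odd m by rewrite -coprime2n.
have [s1 [b [mb b4]]] : exists (s : nat) (b : int), m%:Z = (-1) ^+ s * b /\ (4 %| b - 1)%Z.
  have [h|h] : (m %% 4 = 1)%N \/ (m %% 4 = 3)%N by move: om; lia.
    by exists 0%N, m%:Z; split; [rewrite mul1r | lia].
  by exists 1%N, (- m%:Z); split; [rewrite expr1 mulN1r opprK | lia].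
have [s2 Bs] : exists s : nat, B = (-1) ^+ s * `|B|%N%:Z.
  case: (ltP B 0) => h; [exists 1%N | exists 0%N]; rewrite ?expr1 ?expr0; lia.
pose s := (s1 + s2)%N; pose r := logn 2 `|B|%N.
have BE : B = (-1) ^+ s * 2 ^+ r * b; last first.
  by exists s, r, b; split; rewrite // BE !exprMn sqrr_sign mul1r.
rewrite /s /r.
by rewrite {1}Bs {1}mE PoszM mb -[Posz (2 ^ _)]natz natrX exprD; ring.
Qed.

Lemma odd_sqr_mod8 (a : int) : odd `|a|%N -> exists t, a ^+ 2 = 8 * t + 1.
Proof.
move=> oa; have [k aE] : exists k, a = 2 * k + 1 by exists (a %/ 2)%Z; move: oa; lia.
have [m [e [he kE]]] : exists m e : int, (e = 0 \/ e = -1) /\ k = 2 * m + e.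
  by exists ((k + 1)%R %/ 2)%Z, (((k + 1)%R %% 2)%Z - 1); lia.
by case: he kE => -> kE; rewrite aE kE; [exists (m * (2 * m + 1))|exists (m * (2 * m - 1))]; ring.
Qed.

Section NormForm.
Variables (p : nat) (A B : int).
Hypotheses (pp : prime p) (p_gt3 : (3 < p)%N) (pE : p%:Z = A ^+ 2 + 3 * B ^+ 2).
Local Notation chi l a := (qchar ((a)%:~R : 'F_l)).

Let oddp : odd p.
Proof. by case/even_prime: pp p_gt3 => // ->. Qed.
Let oddFp : odd #|'F_p|. Proof. by rewrite card_Fp. Qed.

(** If p divided one of A, B it would divide the other, and then p^2 would divide p. *)
Lemma norm_form_ndvd : ~~ (p %| A)%Z /\ ~~ (p %| B)%Z.
Proof.
have sq (c : int) : (p %| c ^+ 2)%Z -> (p %| c)%Z by rewrite !dvdzE abszX Euclid_dvdX // andbT.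
have both : ~ ((p %| A)%Z /\ (p %| B)%Z).
  move=> [/dvdzP[a aE] /dvdzP[b bE]].
  have : p%:Z * (p%:Z * (a ^+ 2 + 3 * b ^+ 2)) = p%:Z * 1.
    by rewrite mulr1 [RHS]pE aE bE; ring.
  have p0 : p%:Z != 0 by move: p_gt3; lia.
  move/(mulfI p0) => h; have : (p%:Z %| 1)%Z.
    by apply/dvdzP; exists (a ^+ 2 + 3 * b ^+ 2); rewrite mulrC h.
  by rewrite dvdzE /= dvdn1; move: p_gt3; lia.
split; apply/negP => h; apply: both; split=> //.
- have : (p %| 3 * B ^+ 2)%Z.
    have -> : 3 * B ^+ 2 = p%:Z - A * A by rewrite pE; ring.
    by rewrite rpredB // dvdz_mulr.
  rewrite !dvdzE abszM Euclid_dvdM // => /orP[/dvdn_leq/=|]; first by move: p_gt3; lia.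
  by rewrite abszX Euclid_dvdX // andbT.
- apply: sq; have -> : A ^+ 2 = p%:Z - (3 * B) * B by rewrite pE; ring.
  by rewrite rpredB // dvdz_mull.
Qed.

Lemma norm_form_ndvd3 : ~~ (3 %| A)%Z.
Proof.
apply/negP => /dvdzP[a aE]; have : (3 %| p%:Z)%Z.
  by rewrite pE aE; apply/dvdzP; exists (3 * a ^+ 2 + B ^+ 2); ring.
by rewrite dvdzE /= dvdn_prime2 //; move: p_gt3; lia.
Qed.

Let chiM (l : nat) (pl : prime l) (ol : odd l) (x y : int) :
  chi l (x * y) = chi l x * chi l y.
Proof. by rewrite intrM qcharM // card_Fp. Qed.

Let chi1 (l : nat) : chi l 1 = 1. Proof. exact: qchar1. Qed.

Let pl_neq l (c : int) : ~~ (p %| c)%Z -> (l %| `|c|)%N -> p != l.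
Proof. by move=> pc lc; apply: contraNneq pc => ->; rewrite dvdzE. Qed.

Let norm_form_Fp l : p%:R = A%:~R ^+ 2 + 3 * B%:~R ^+ 2 :> 'F_l.
Proof. by rewrite -[LHS]/(p%:Z%:~R) pE rmorphD rmorphM !rmorphXn. Qed.

Let int_Fp0 l (c : int) : prime l -> (c%:~R == 0 :> 'F_l) = (l %| `|c|)%N.
Proof. by move=> pl; rewrite (intr_eq0_pchar _ (pchar_Fp pl)) dvdzE. Qed.

(** For an odd prime l dividing B, reciprocity turns chi_p of [pstar l] into chi_l(p), and p = A^2
    is a square mod l. *)
Lemma norm_form_chi_B (b : int) : (4 %| b - 1)%Z -> (b %| B)%Z -> chi p b = 1.
Proof.
move=> b4 bB; apply: (@pstar_morph_eq (fun a => chi p a) (fun=> 1)) => // [|l pl ol lb].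
- by move=> x y; apply: chiM.
have lB : (l %| `|B|)%N by apply: dvdn_trans lb _; rewrite -dvdzE.
have npl := pl_neq norm_form_ndvd.2 lB.
rewrite (quadratic_reciprocity pp pl oddp ol npl).
have hB : B%:~R = 0 :> 'F_l by apply/eqP; rewrite int_Fp0.
have p0 : p%:R != 0 :> 'F_l.
  by rewrite -(dvdn_pcharf (pchar_Fp pl)) dvdn_prime2 // eq_sym.
move: p0; rewrite norm_form_Fp hB expr0n mulr0 addr0 expf_eq0 /= => A0.
by rewrite expr2 qcharM ?card_Fp // qchar_sqr.
Qed.

(** For an odd prime l dividing A one has p = 3 B^2 mod l, so chi_l(p) = chi_l(3); reciprocity is
    applied once at p and once at 3. *)
Lemma norm_form_chi_A (a : int) : (4 %| a - 1)%Z -> (a %| A)%Z -> chi p a = chi 3 a.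
Proof.
move=> a4 aA; apply: (@pstar_morph_eq (fun a => chi p a) (fun a => chi 3 a)) => // [||l pl ol la].
- by move=> x y; apply: chiM.
- by move=> x y; apply: chiM.
have lA : (l %| `|A|)%N by apply: dvdn_trans la _; rewrite -dvdzE.
have npl := pl_neq norm_form_ndvd.1 lA.
have l3 : 3%N != l.
  by apply: contraNneq norm_form_ndvd3 => l3; move: lA; rewrite -l3.
rewrite (quadratic_reciprocity pp pl oddp ol npl).
rewrite (quadratic_reciprocity (isT : prime 3) pl isT ol l3).
have hA : A%:~R = 0 :> 'F_l by apply/eqP; rewrite int_Fp0.
have p0 : p%:R != 0 :> 'F_l.
  by rewrite -(dvdn_pcharf (pchar_Fp pl)) dvdn_prime2 // eq_sym.
move: p0; rewrite norm_form_Fp hA expr0n add0r mulf_eq0 negb_or expf_eq0 /= => /andP[_ B0].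
by rewrite qcharM ?card_Fp // expr2 [X in _ * X = _]qcharM ?card_Fp // qchar_sqr // mulr1.
Qed.

Let chi2 : chi p 2 = if (p %% 8 == 1)%N || (p %% 8 == 7)%N then 1 else -1.
Proof. exact: qchar_2. Qed.

Let chiN1 : chi p (-1) = (-1) ^+ (p.-1)./2.
Proof. by rewrite -(qchar_N1 pp oddp) mulrN1z. Qed.

Let chi3N1 : chi 3 (-1) = -1.
Proof. by rewrite mulrN1z qchar_N1. Qed.

Let chi3_2 : chi 3 2 = -1.
Proof. exact: (@qchar_2 3). Qed.

Let chiX l (pl : prime l) (ol : odd l) a n : chi l (a ^+ n) = chi l a ^+ n.
Proof. by rewrite rmorphXn qcharX // card_Fp. Qed.

(** An even A would leave p congruent to 3 B^2, hence to 0 or 3, mod 4. *)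
Lemma norm_form_oddA : (p %% 4)%N = 1%N -> odd `|A|%N.
Proof.
move=> p4.
apply/negPn/negP => eA; have [a aE] : exists a, A = 2 * a by exists (A %/ 2)%Z; move: eA; lia.
have [b [e [he bE]]] : exists b e : int, (e = 0 \/ e = 1) /\ B = 2 * b + e.
  by exists (B %/ 2)%Z, (B %% 2)%Z; lia.
have : p%:Z = 4 * (a ^+ 2 + 3 * b ^+ 2 + 3 * b * e) + 3 * e ^+ 2 by rewrite pE aE bE; ring.
by move: p4; case: he => ->; rewrite ?expr0n ?expr1n; clear; lia.
Qed.

Lemma norm_form_sign1 : (p %% 4)%N = 1%N ->
  chi p A * chi p B * chi 3 A = (-1) ^+ ((p - 1) %/ 4)%N * (if (4 %| A - 1)%Z then 1 else -1).
Proof.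
move=> p4; have [nA nB] := norm_form_ndvd.
have A0 : A != 0 by apply: contraNneq nA => ->; rewrite dvdz0.
have B0 : B != 0 by apply: contraNneq nB => ->; rewrite dvdz0.
have N1 : chi p (-1) = 1.
  by rewrite chiN1 -signr_odd (_ : odd _ = false) //; move: p4; lia.
have c3 : chi 3 A * chi 3 A = 1.
  by rewrite qchar_sqr // int_Fp0 //; have := norm_form_ndvd3; rewrite dvdzE.
have oA := norm_form_oddA p4.
(* If A = 3 mod 4, pass to -A: the sign is invisible to chi_p, as p = 1 mod 4, but not to chi_3. *)
have hA : chi p A = chi 3 A * (if (4 %| A - 1)%Z then 1 else -1).
  case: ifP => A4; first by rewrite mulr1; apply: norm_form_chi_A.
  have A4' : (4 %| - A - 1)%Z by move: A4 oA; clear; lia.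
  have h := norm_form_chi_A A4' (_ : (- A %| A)%Z).
  have hN l (pl : prime l) (ol : odd l) : chi l A = chi l (-1) * chi l (- A).
    by rewrite -chiM // mulN1r opprK.
  rewrite (hN p) // (hN 3%N) // N1 mul1r h; last by rewrite dvdzE abszN.
  by rewrite chi3N1 mulN1r mulrN1 opprK.
have [s [r [b [BE Bsq b4]]]] := int_2adic B0.
have hB : chi p B = (-1) ^+ ((p - 1) %/ 4)%N.
  rewrite BE chiM // chiM // !chiX // N1 expr1n mul1r.
  rewrite (norm_form_chi_B b4) ?mulr1; last by rewrite BE dvdz_mull.
  rewrite chi2 -signr_odd; have [t At] := odd_sqr_mod8 oA.
  (* Here chi_p(B) = chi_p(2)^r. The valuation r of B determines p mod 8: r = 0 contradicts p = 1
     mod 4, r = 1 gives 5, and r > 1 gives 1. *)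
  case: r Bsq {BE} => [|[|r]] Bsq.
  - have [u Bu] : exists u, B ^+ 2 = 8 * u + 1.
      by rewrite Bsq expr0 expr1n mul1r; apply: odd_sqr_mod8; move: b4; clear; lia.
    by move: pE p4; rewrite At Bu; clear; lia.
  - have [u Bu] : exists u, b ^+ 2 = 8 * u + 1 by apply: odd_sqr_mod8; move: b4; clear; lia.
    have B2 : B ^+ 2 = 4 * b ^+ 2 by rewrite Bsq expr1.
    have p8 : (p %% 8 = 5)%N by move: pE; rewrite At B2 Bu; clear; lia.
    by rewrite p8 expr1 (_ : odd _ = true) //; move: p8; clear; lia.
  - have B2 : B ^+ 2 = 16 * (2 ^+ r * b) ^+ 2.
      by rewrite Bsq !exprS; ring.
    have p8 : (p %% 8 = 1)%N by move: pE; rewrite At B2; clear; lia.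
    by rewrite p8 expr1n (_ : odd _ = false) //; move: p8; clear; lia.
rewrite hA hB -[RHS]mul1r -c3; ring.
Qed.

Lemma norm_form_sign3 : (p %% 4)%N = 3%N -> (4 %| B - 1)%Z ->
  chi p A * chi p B * chi 3 A = - (-1) ^+ ((p + 1) %/ 4)%N.
Proof.
move=> p4 B4; have [nA nB] := norm_form_ndvd.
have A0 : A != 0 by apply: contraNneq nA => ->; rewrite dvdz0.
have N1 : chi p (-1) = -1.
  by rewrite chiN1 -signr_odd (_ : odd _ = true) //; move: p4; lia.
rewrite [chi p B]norm_form_chi_B ?dvdzz // mulr1.
have [s [r [a [AE Asq a4]]]] := int_2adic A0.
have aA : (a %| A)%Z by rewrite AE dvdz_mull.
have c3 : chi 3 a * chi 3 a = 1.
  rewrite qchar_sqr // int_Fp0 //; apply: contra norm_form_ndvd3 => h.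
  by apply: dvdz_trans aA; rewrite dvdzE.
(* The sign of A disappears because chi_p(-1) = chi_3(-1) = -1, and each factor 2 contributes
   chi_p(2) chi_3(2) = - chi_p(2). *)
have -> : chi p A * chi 3 A = (- chi p 2) ^+ r.
  rewrite AE !chiM // !chiX // N1 (norm_form_chi_A a4 aA).
  rewrite chi3N1 chi3_2.
  rewrite mulrACA c3 mulr1 mulrACA -exprMn mulrNN mulr1 expr1n mul1r -exprMn.
  by rewrite mulrN1.
rewrite chi2 -signr_odd; have [t Bt] : exists t, B ^+ 2 = 8 * t + 1.
  by apply: odd_sqr_mod8; move: B4; clear; lia.
case: r Asq {AE aA} => [|[|r]] Asq.
- have [u Au] : exists u, A ^+ 2 = 8 * u + 1.
    by rewrite Asq expr0 expr1n mul1r; apply: odd_sqr_mod8; move: a4; clear; lia.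
  by move: pE p4; rewrite Bt Au; clear; lia.
- have [u Au] : exists u, a ^+ 2 = 8 * u + 1 by apply: odd_sqr_mod8; move: a4; clear; lia.
  have A2 : A ^+ 2 = 4 * a ^+ 2 by rewrite Asq expr1.
  have p8 : (p %% 8 = 7)%N by move: pE; rewrite Bt A2 Au; clear; lia.
  by rewrite p8 expr1 (_ : odd _ = false) //; move: p8; clear; lia.
- have A2 : A ^+ 2 = 16 * (2 ^+ r * a) ^+ 2.
    by rewrite Asq !exprS; ring.
  have p8 : (p %% 8 = 3)%N by move: pE; rewrite Bt A2; clear; lia.
  by rewrite p8 opprK expr1n (_ : odd _ = true) //; move: p8; clear; lia.
Qed.

End NormForm.

(** * The sum over an index n with 4n = -1 *)

(** Both sides are the coefficient of X^n in (1 + x X)^n (1 + X)^n; the right one comes from 1 + x X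
    = (1 - x) + x (1 + X). *)
Lemma sum_bin_sqr (R : comNzRingType) (x : R) (n : nat) :
  \sum_(k < n.+1) 'C(n, k)%:R ^+ 2 * x ^+ k =
  \sum_(k < n.+1) ('C(n, k) * 'C(n + k, k))%:R * x ^+ k * (1 - x) ^+ (n - k).
Proof.
pose P : {poly R} := (1 + x *: 'X) ^+ n * ('X + 1) ^+ n.
have coefX1 m i : (('X + 1 : {poly R}) ^+ m)`_i = 'C(m, i)%:R.
  rewrite exprD1n coef_sum; have [lt_mi|le_im] := ltnP m i.
    rewrite bin_small // big1 // => -[j /= lj] _.
    by rewrite coefMn coefXn gtn_eqF ?mul0rn //; lia.
  have h : (i < m.+1)%N by rewrite ltnS.
  rewrite (bigD1 (Ordinal h)) //= coefMn coefXn eqxx big1 ?addr0 // => j.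
  by rewrite -val_eqE /= => ji; rewrite coefMn coefXn eq_sym (negPf ji) mul0rn.
have e1 : P`_n = \sum_(k < n.+1) 'C(n, k)%:R ^+ 2 * x ^+ k.
  rewrite /P exprDn mulr_suml coef_sum; apply: eq_bigr => -[k /= lk] _.
  rewrite expr1n mul1r exprZn mulrnAl coefMn -scalerAl coefZ -mulr_natr.
  have kn : (k <= n)%N by [].
  rewrite coefXnM ltnNge kn /= coefX1.
  rewrite bin_sub // -[LHS]mulr_natr.
  move: ('C(n, k)%:R : R) (x ^+ k) => u v; ring.
have e2 : P`_n =
    \sum_(k < n.+1) ('C(n, k) * 'C(n + k, k))%:R * x ^+ k * (1 - x) ^+ (n - k).
  have -> : P = ((1 - x)%:P + x *: ('X + 1)) ^+ n * ('X + 1) ^+ n.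
    by rewrite /P; congr (_ ^+ _ * _); rewrite -!mul_polyC polyCB; ring.
  rewrite exprDn mulr_suml coef_sum; apply: eq_bigr => -[k /= lk] _.
  rewrite exprZn -polyC_exp [in LHS]mulrnAl coefMn -[in LHS]mulrA coefCM -scalerAl coefZ -exprD coefX1.
  rewrite addnC -bin_sub ?leq_addr // addKn natrM -[LHS]mulr_natr.
  move: ('C(n, k)%:R : R) ('C(n + k, k)%:R : R) (x ^+ k) ((1 - x) ^+ (n - k)) => u v w t; ring.
by rewrite -e1 e2.
Qed.

(* The coefficient of [x^(2h)] in [(x^3 + b x^2 + c x)^h]. *)
Lemma coef_quadratic_exp (R : comNzRingType) (b c : R) (h : nat) :
  (('X ^+ 2 + b *: 'X + c%:P) ^+ h)`_h =
  \sum_(0 <= k < (h./2).+1) ('C(h, 2 * k) * 'C(2 * k, k))%:R * c ^+ k * b ^+ (h - 2 * k).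
Proof.
(* Expanding (b X + (c + X^2))^h, the term with (c + X^2)^j must supply X^j, which only an even j
   allows. *)
have coefj j : ((c%:P + 'X ^+ 2 : {poly R}) ^+ j)`_j =
    if odd j then 0 else 'C(j, j./2)%:R * c ^+ (j./2).
  rewrite exprDn coef_sum.
  have term (k : 'I_j.+1) : ((c%:P : {poly R}) ^+ (j - k) * ('X ^+ 2) ^+ k *+ 'C(j, k))`_j =
      if (j == 2 * k)%N then 'C(j, k)%:R * c ^+ (j - k) else 0.
    rewrite coefMn -polyC_exp coefCM -exprM coefXn.
    by case: eqP => _; rewrite ?mulr0 ?mul0rn // mulr1 -[LHS]mulr_natr mulrC.
  rewrite (eq_bigr _ (fun k _ => term k)); case: ifP => oj.
    by rewrite big1 // => k _; case: eqP => // jk; move: jk oj; clear; lia.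
  have jE : j = (2 * j./2)%N by move: oj; lia.
  have hj : (j./2 < j.+1)%N by lia.
  rewrite (bigD1 (Ordinal hj)) //= -jE eqxx big1 ?addr0 => [|k]; last first.
    by rewrite -val_eqE /=; case: (j =P _) => // jk kj; move: jk kj; clear; lia.
  by congr (_ * c ^+ _); lia.
have sum_even (G : nat -> R) : \sum_(0 <= j < h.+1) (if odd j then 0 else G j) =
    \sum_(0 <= k < h./2.+1) G (2 * k)%N.
  elim: h => [|m IH]; first by rewrite !big_nat1.
  rewrite big_nat_recr //= IH; case: ifP => om.
    by rewrite addr0; congr (\sum_(0 <= k < _) _); move: om; lia.
  have -> : (uphalf m).+1 = (m./2.+1).+1 by move: om; lia.
  by rewrite [RHS]big_nat_recr //=; congr (_ + G _); move: om; lia.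
rewrite (_ : 'X ^+ 2 + _ + _ = b *: 'X + (c%:P + 'X ^+ 2)); last first.
  by rewrite addrAC addrC [c%:P + _]addrC.
rewrite exprDn coef_sum.
transitivity (\sum_(0 <= j < h.+1) (if odd j then 0 else
    'C(h, j)%:R * b ^+ (h - j) * ('C(j, j./2)%:R * c ^+ (j./2)))).
  rewrite big_mkord; apply: eq_bigr => -[j /= lj] _; have jh : (j <= h)%N by [].
  rewrite coefMn exprZn -scalerAl coefZ coefXnM ltnNge leq_subr /= subKn // coefj.
  case: (odd j); rewrite ?mulr0 ?mul0rn // -[LHS]mulr_natr.
  by rewrite [LHS]mulrC [LHS]mulrA.
rewrite sum_even; apply: eq_bigr => k _; rewrite mul2n doubleK natrM.
move: ('C(h, k.*2)%:R : R) (b ^+ _) ('C(k.*2, k)%:R : R) (c ^+ k) => u v w t; ring.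
Qed.

Lemma natr_ffactSr (R : comNzRingType) (n k : nat) :
  (n ^_ k.+1)%:R = (n ^_ k)%:R * (n%:R - k%:R) :> R.
Proof.
rewrite ffactnSr natrM; have [lt_nk|le_kn] := ltnP n k; last by rewrite natrB.
by rewrite ffact_small // !mul0r.
Qed.

(* With [n = -1/4] and [h = -1/2] this is Gauss's multiplication of
   [(1/4)_k (3/4)_k] into [(1/2)_(2k)]. *)
Lemma bin_quarter_half (F : fieldType) (n h k : nat) :
  4 * n%:R = -1 :> F -> 2 * h%:R = -1 :> F -> (k`!)%:R != 0 :> F ->
  ('C(n, k) * 'C(n + k, k))%:R * (-4) ^+ k = ('C(h, 2 * k) * 'C(2 * k, k))%:R :> F.
Proof.
move=> hn hh k0.
(* Falling factorials keep k! out of the induction; it is cancelled afterwards. *)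
have ff : (n ^_ k)%:R * ((n + k) ^_ k)%:R * (-4) ^+ k = (h ^_ (2 * k))%:R :> F.
  elim: k {k0} => [|k IH]; first by rewrite !ffactn0 !mul1r.
  have -> : (2 * k.+1 = (2 * k).+2)%N by lia.
  rewrite addnS (ffactnS (n + k).+1) natrM /= !natr_ffactSr -IH exprS.
  rewrite -[((n + k).+1)%:R]natr1 natrD -[((2 * k).+1)%:R]natr1 natrM.
  move: (n ^_ k)%:R ((n + k) ^_ k)%:R ((-4) ^+ k) => u v w.
  move: hn hh; move: (n%:R) (h%:R) (k%:R) => x y t hn hh.
  have four0 : 4 != 0 :> F.
    by apply: contra_eq_neq hn => ->; rewrite mul0r eq_sym oppr_eq0 oner_eq0.
  apply: (mulfI four0).
  (* After multiplication by 4, both growth factors equal (4k+1)(4k+3) because 4n = 2h = -1. *)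
  transitivity (u * v * w * (- (4 * x - 4 * t) * (4 * x + 4 * t + 4))); first by ring.
  transitivity (u * v * w * ((2 * y - 4 * t) * (2 * y - 4 * t - 2))); last by ring.
  by rewrite hn hh; ring.
apply: (mulfI k0); apply: (mulfI k0).
have -> : (k`!)%:R * ((k`!)%:R * (('C(n, k) * 'C(n + k, k))%:R * (-4) ^+ k)) =
    ('C(n, k) * k`!)%:R * ('C(n + k, k) * k`!)%:R * (-4) ^+ k :> F.
  by rewrite !natrM; ring.
rewrite !bin_ffact ff -bin_ffact.
have -> : ((2 * k)`! = 'C(2 * k, k) * (k`! * k`!))%N.
  by rewrite -(bin_fact (_ : k <= 2 * k)%N) ?leq_pmull //; congr (_ * (_ * _`!))%N; lia.
by rewrite !natrM; ring.
Qed.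

Lemma cubsum1_eq0 (F : finFieldType) : odd #|F| -> #|F| = 2 %[mod 3] -> cubsum (1 : F) = 0.
Proof.
move=> oddF h; have q1 := card_finField_gt1 F.
(* For q = 3m + 2 one has 3(2m+1) = q + (q-1), so the power 2m+1 inverts cubing. *)
have cubeK : cancel (fun x : F => x ^+ 3) (fun x => x ^+ (2 * (#|F| %/ 3)).+1).
  move=> x; rewrite -exprM (_ : (3 * _ = #|F| + #|F|.-1)%N); last by move: h q1; clear; lia.
  by rewrite exprD expf_card -exprS prednK ?expf_card // ltnW.
rewrite /cubsum -[RHS](sum_qchar oddF) [RHS](reindex_inj (addIr 1)) /=.
by rewrite [RHS](reindex_inj (can_inj cubeK)).
Qed.

Section QuarterSum.
Variables (F : finFieldType) (n h : nat).
Hypotheses (oddF : odd #|F|) (F3 : 3 != 0 :> F).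
Hypotheses (hE : h = (#|F|.-1)./2) (hn : 4 * n%:R = -1 :> F) (hle : (h <= 2 * n)%N).
Hypothesis fact_n : (n`!)%:R != 0 :> F.

Let hh : 2 * h%:R = -1 :> F.
Proof.
have q1 := card_finField_gt1 F.
rewrite -natrM hE (_ : (2 * _ = #|F| - 1)%N); last by move: oddF q1; clear; lia.
by rewrite natrB ?natr_card_finField ?sub0r // ltnW.
Qed.

Let fact_le k : (k <= n)%N -> (k`!)%:R != 0 :> F.
Proof.
move=> kn; apply: contraNneq fact_n => k0; rewrite -(bin_fact kn) !natrM k0.
by rewrite mul0r mulr0.
Qed.

(** Multiplying by X^h moves the coefficient to X^(q-1), where [sum_horner] reads it as minus a sum
    of values. Replacing x by -x there produces the sign (-1)^h. *)
Lemma coef_cube_shift : (('X ^+ 2 + 3 *: 'X + 3%:P : {poly F}) ^+ h)`_h =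
  - ((-1) ^+ h * (cubsum (1 : F))%:~R).
Proof.
have q1 := card_finField_gt1 F.
have qh : #|F|.-1 = (h + h)%N by rewrite hE; move: oddF q1; clear; lia.
pose P : {poly F} := ('X * ('X ^+ 2 + 3 *: 'X + 3%:P)) ^+ h.
have PE : P`_(#|F|.-1) = (('X ^+ 2 + 3 *: 'X + 3%:P : {poly F}) ^+ h)`_h.
  by rewrite /P exprMn coefXnM qh ltnNge leq_addr /= addKn.
have hP x : P.[x] = ((x + 1) ^+ 3 - 1) ^+ h.
  rewrite /P horner_exp hornerM !hornerD hornerXn hornerZ hornerX hornerC; congr (_ ^+ _).
  by ring.
have sP : (size P <= (#|F|.-1).*2)%N.
  apply: leq_trans (size_poly_exp_leq _ _) _.
  have sQ : (size ('X * ('X ^+ 2 + 3 *: 'X + 3%:P) : {poly F})%R <= 4)%N.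
    apply: leq_trans (size_polyMleq _ _) _; rewrite size_polyX /= ltnS.
    apply: leq_trans (size_polyD _ _) _; rewrite geq_max (leq_trans (size_polyC_leq1 _)) // andbT.
    apply: leq_trans (size_polyD _ _) _; rewrite geq_max size_polyXn /=.
    by rewrite (leq_trans (size_scale_leq _ _)) // size_polyX.
  move: sQ; set m := size _ => sQ; have : ((m.-1 * h) <= 3 * h)%N by rewrite leq_mul2r; move: sQ; clear; lia.
  have h0 : (0 < h)%N by rewrite hE; move: q1 oddF; clear; lia.
  by rewrite qh; move: (m.-1 * h)%N h0; clear; lia.
rewrite -PE -[LHS]opprK -sum_horner //; congr (- _).
rewrite (eq_bigr _ (fun x _ => hP x)).
transitivity (\sum_(x : F) (x ^+ 3 - 1) ^+ h).
  by rewrite [RHS](reindex_inj (addIr 1)).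
rewrite (reindex_inj oppr_inj) /= rmorph_sum mulr_sumr; apply: eq_bigr => x _ /=.
rewrite qcharE // -hE -exprMn; congr (_ ^+ _); ring.
Qed.

Lemma quarter_sum : \sum_(k < n.+1) 'C(n, k)%:R ^+ 2 * 4 ^+ k =
  - ((-3) ^+ n * (-3) ^+ h * (cubsum (1 : F))%:~R) :> F.
Proof.
have q1 := card_finField_gt1 F.
(* This makes 3^h * 3^(h-2k) a substitute for 3^(-2k). *)
have h3 : (3 : F) ^+ h * 3 ^+ h = 1.
  rewrite -exprD (_ : (h + h = #|F|.-1)%N) ?expf_card_pred // hE.
  by move: oddF q1; clear; lia.
have key k : (k <= n)%N ->
    ('C(n, k) * 'C(n + k, k))%:R * 4 ^+ k * (1 - 4) ^+ (n - k) =
    (-3) ^+ n * 3 ^+ h * (('C(h, 2 * k) * 'C(2 * k, k))%:R * 3 ^+ k * 3 ^+ (h - 2 * k)) :> F.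
  (* For 2k > h the binomial on the right is 0, and [bin_quarter_half] forces the left product to
     vanish in F, as 4 is invertible. *)
  move=> kn; have [hk|kh] := ltnP h (2 * k)%N.
    rewrite -(bin_quarter_half hn hh (fact_le kn)).
    have := bin_quarter_half hn hh (fact_le kn); rewrite [in X in _ = X]bin_small // mul0n.
    move/eqP; rewrite mulf_eq0 expf_eq0 oppr_eq0 => /orP[/eqP ->|]; first by rewrite !mul0r mulr0.
    move=> /andP[_ /eqP f0]; have := hn; rewrite f0 mul0r => /esym/eqP.
    by rewrite oppr_eq0 oner_eq0.
  rewrite -(bin_quarter_half hn hh (fact_le kn)).
  have -> : (1 - 4 : F) = -3 by ring.
  have e1 : (-3) ^+ n = (-3) ^+ (n - k) * (-3) ^+ k :> F by rewrite -exprD subnK.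
  have e2 : (3 : F) ^+ h = 3 ^+ (h - 2 * k) * (3 ^+ k * 3 ^+ k).
    by rewrite -!exprD; congr (_ ^+ _); move: kh; clear; lia.
  have e3 : (-4) ^+ k = (-1) ^+ k * 4 ^+ k :> F by rewrite -exprMn mulN1r.
  have e4 : (-3) ^+ k = (-1) ^+ k * 3 ^+ k :> F by rewrite -exprMn mulN1r.
  have e5 : (-1) ^+ k * (-1) ^+ k = 1 :> F by rewrite -exprMn mulrNN mulr1 expr1n.
  rewrite e1 e3 e4.
  move: (('C(n, k) * 'C(n + k, k))%:R : F) => c.
  transitivity (((-1) ^+ k * (-1) ^+ k) * (3 ^+ h * (3 ^+ (h - 2 * k) * (3 ^+ k * 3 ^+ k))) *
    (c * 4 ^+ k * (-3) ^+ (n - k))); first by rewrite e5 -e2 h3 !mul1r.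
  move: (3 ^+ h) (3 ^+ k) (3 ^+ (h - 2 * k)) (4 ^+ k) ((-1) ^+ k) ((-3) ^+ (n - k)) => x1 x2 x3 x4 x5 x6.
  by ring.
rewrite sum_bin_sqr (eq_bigr _ (fun (k : 'I_n.+1) _ => key k (ltn_ord k))) -mulr_sumr.
have -> : \sum_(k < n.+1) (('C(h, 2 * k) * 'C(2 * k, k))%:R * 3 ^+ k * 3 ^+ (h - 2 * k) : F) =
   - ((-1) ^+ h * (cubsum (1 : F))%:~R).
  rewrite -coef_cube_shift coef_quadratic_exp.
  rewrite -(big_mkord xpredT (fun k => ('C(h, 2 * k) * 'C(2 * k, k))%:R * 3 ^+ k * 3 ^+ (h - 2 * k) : F)).
  (* As h <= 2n, the range up to h/2 fits inside the range up to n, and the surplus terms have C(h,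
     2k) = 0. *)
  rewrite (@big_cat_nat _ _ _ (h./2).+1) //=; last by move: hle; clear; lia.
  rewrite [X in _ + X]big_nat [X in _ + X]big1 ?addr0 // => k /andP[hk _].
  by rewrite bin_small ?mul0n ?mul0r //; move: hk; clear; lia.
rewrite mulrN; congr (- _); rewrite [(-3) ^+ h](_ : _ = (-1) ^+ h * 3 ^+ h); last by rewrite -exprMn mulN1r.
by rewrite !mulrA; congr (_ * _); rewrite mulrAC -!mulrA; congr (_ * _); rewrite mulrC.
Qed.

End QuarterSum.

(** * Reduction of p-integral rationals modulo p *)

(** The product of A B' - A' B and -A B' - A' B is a multiple of p, so after a sign change of B' the
    prime p divides A B' - A' B. Brahmagupta's identity (A A' + 3 B B')^2 + 3 (A B' - A' B)^2 = p^2
    then forces this multiple of p to be 0. *)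
Lemma norm_form_unique (p : nat) (A B A' B' : int) : prime p ->
  p%:Z = A ^+ 2 + 3 * B ^+ 2 -> p%:Z = A' ^+ 2 + 3 * B' ^+ 2 ->
  A' = A \/ A' = - A.
Proof.
move=> pp pE pE'.
suff h (b : int) : p%:Z = A' ^+ 2 + 3 * b ^+ 2 -> (p %| A * b - A' * B)%Z -> A' ^+ 2 = A ^+ 2.
  have : A' ^+ 2 = A ^+ 2.
    have : (p %| (A * B' - A' * B) * (A * - B' - A' * B))%Z.
      apply/dvdzP; exists (B ^+ 2 - B' ^+ 2).
      transitivity ((p%:Z - 3 * B' ^+ 2) * B ^+ 2 - (p%:Z - 3 * B ^+ 2) * B' ^+ 2).
        by rewrite {1}pE' pE; ring.
      by ring.
    rewrite dvdzE abszM Euclid_dvdM // => /orP[] hd; first by apply: (h B'); rewrite // dvdzE.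
    by apply: (h (- B')); rewrite ?sqrrN // dvdzE.
  by move/eqP; rewrite eqf_sqr => /orP[] /eqP; [left | right].
move=> {}pE' /dvdzP[k kE].
have p0 : p%:Z != 0 by rewrite eqz_nat -lt0n prime_gt0.
have k0 : k = 0.
  have e : (A * A' + 3 * B * b) ^+ 2 + 3 * (k * p%:Z) ^+ 2 = p%:Z ^+ 2.
    by rewrite -kE [in RHS]expr2 {1}pE pE'; ring.
  have pp2 : 0 < p%:Z ^+ 2 by rewrite exprn_even_gt0.
  apply/eqP; apply: contraTT pp2 => k0; rewrite -leNgt.
  have k1 : 0 < k ^+ 2 by rewrite exprn_even_gt0.
  have := sqr_ge0 (A * A' + 3 * B * b).
  move: e; rewrite exprMn.
  move: (p%:Z ^+ 2) (k ^+ 2) k1 ((_ + _) ^+ 2) (sqr_ge0 p%:Z) => P K K1 Q P0 e Q0.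
  have KP : P <= K * P by rewrite ler_peMl // -gtz0_ge1.
  by move: e KP P0 Q0; move: (K * P) => KP; clear; lia.
have e : A * b = A' * B by apply/eqP; rewrite -subr_eq0 kE k0 mul0r.
apply: (mulfI p0).
transitivity (A' ^+ 2 * (A ^+ 2) + 3 * (A' * B) ^+ 2); first by rewrite pE; ring.
by rewrite -e pE'; ring.
Qed.

(** The fraction need not be in lowest terms, which makes stability under arithmetic immediate;
    p-integrality travels along with the residue. *)
Definition reduces_to (p : nat) (x : rat) (v : 'F_p) : Prop :=
  exists a b : int, [/\ b%:~R != 0 :> 'F_p, x = a%:~R / b%:~R & v = a%:~R / b%:~R].

Section Reduction.
Variable p : nat.
Hypothesis pp : prime p.
Implicit Types (x y : rat) (u v : 'F_p).

Let rat_neq0 (b : int) : b%:~R != 0 :> 'F_p -> b%:~R != 0 :> rat.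
Proof. by apply: contra; rewrite intr_eq0 => /eqP ->. Qed.

Lemma reduces_int (a : int) : @reduces_to p a%:~R a%:~R.
Proof. by exists a, 1; rewrite !divr1 oner_eq0. Qed.

Lemma reduces_nat (a : nat) : @reduces_to p a%:R a%:R.
Proof. exact: (reduces_int a). Qed.

Lemma reduces_add x y u v :
  reduces_to x u -> reduces_to y v -> reduces_to (x + y) (u + v).
Proof.
move=> [a [b [b0 -> ->]]] [c [d [d0 -> ->]]].
exists (a * d + c * b), (b * d); rewrite !rmorphD !rmorphM /=; split.
- by rewrite mulf_neq0.
- by rewrite addf_div ?rat_neq0.
- by rewrite addf_div.
Qed.

Lemma reduces_mul x y u v :
  reduces_to x u -> reduces_to y v -> reduces_to (x * y) (u * v).
Proof.
move=> [a [b [b0 -> ->]]] [c [d [d0 -> ->]]].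
by exists (a * c), (b * d); rewrite !rmorphM /= !mulf_div mulf_neq0.
Qed.

Lemma reduces_opp x u : reduces_to x u -> reduces_to (- x) (- u).
Proof.
by move=> [a [b [b0 -> ->]]]; exists (- a), b; rewrite !rmorphN /= !mulNr.
Qed.

Lemma reduces_sub x y u v :
  reduces_to x u -> reduces_to y v -> reduces_to (x - y) (u - v).
Proof. by move=> hx hy; apply: reduces_add => //; apply: reduces_opp. Qed.

Lemma reduces_inv x u : u != 0 -> reduces_to x u -> reduces_to x^-1 u^-1.
Proof.
move=> u0 [a [b [b0 -> uE]]]; exists b, a; rewrite !invf_div uE invf_div; split=> //.
by apply: contraNneq u0; rewrite uE => ->; rewrite mul0r.
Qed.

Lemma reduces_exp x u n : reduces_to x u -> reduces_to (x ^+ n) (u ^+ n).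
Proof.
move=> hx; elim: n => [|n IH]; first exact: (reduces_int 1).
by rewrite !exprS; apply: reduces_mul.
Qed.

Lemma reduces_sum (I : Type) (r : seq I) (P : pred I) (f : I -> rat) (g : I -> 'F_p) :
  (forall i, P i -> reduces_to (f i) (g i)) ->
  reduces_to (\sum_(i <- r | P i) f i) (\sum_(i <- r | P i) g i).
Proof.
move=> h; apply: (big_rec2 (fun x u => reduces_to x u)); first exact: (reduces_int 0).
by move=> i x u Pi; apply: reduces_add; apply: h.
Qed.

Lemma reduces_prod (I : Type) (r : seq I) (P : pred I) (f : I -> rat) (g : I -> 'F_p) :
  (forall i, P i -> reduces_to (f i) (g i)) ->
  reduces_to (\prod_(i <- r | P i) f i) (\prod_(i <- r | P i) g i).
Proof.
move=> h; apply: (big_rec2 (fun x u => reduces_to x u)); first exact: (reduces_int 1).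
by move=> i x u Pi; apply: reduces_mul; apply: h.
Qed.

Let numden (a b : int) : b%:~R != 0 :> 'F_p ->
  numq (a%:~R / b%:~R) * b = a * denq (a%:~R / b%:~R).
Proof.
move=> b0; have := rat_neq0 b0; set x := a%:~R / b%:~R => b0'.
apply/eqP; rewrite -(eqr_int rat) !intrM; apply/eqP.
have d0 : (denq x)%:~R != 0 :> rat by rewrite intr_eq0 denq_neq0.
apply: (mulIf (invr_neq0 d0)); rewrite mulfK // mulrAC divq_num_den.
by rewrite /x divfK.
Qed.

Lemma reduces_qint x u : reduces_to x u -> qint_at p x.
Proof.
move=> [a [b [b0 -> _]]]; rewrite /qint_at; have nd := numden a b0.
rewrite coprimezE coprime_sym prime_coprime //.
apply: contraNN b0 => pd; rewrite (intr_eq0_pchar _ (pchar_Fp pp)).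
have : (p %| numq (a%:~R / b%:~R) * b)%Z by rewrite nd dvdz_mull // dvdzE.
rewrite Gauss_dvdzr // coprimezE.
have := coprime_num_den (a%:~R / b%:~R) => cnd.
by rewrite /= coprime_sym; apply: coprime_dvdr pd cnd.
Qed.

Lemma reduces_qcong x y u : reduces_to x u -> reduces_to y u -> qcong p x y.
Proof.
move=> hx hy; split; [exact: reduces_qint hx | exact: reduces_qint hy |].
have := reduces_sub hx hy; rewrite subrr => -[a [b [b0 -> /esym/eqP]]].
rewrite mulf_eq0 invr_eq0 (negPf b0) orbF (intr_eq0_pchar _ (pchar_Fp pp)) => pa.
have : (p %| numq (a%:~R / b%:~R) * b)%Z by rewrite numden // dvdz_mulr.
rewrite Gauss_dvdzl // coprimezE prime_coprime //.
by move: b0; rewrite (intr_eq0_pchar _ (pchar_Fp pp)) dvdzE.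
Qed.

Lemma natr_fact_neq0 k : (k < p)%N -> (k`!)%:R != 0 :> 'F_p.
Proof.
move=> kp; rewrite -(dvdn_pcharf (pchar_Fp pp)); elim: k kp => [|k IH] kp.
  by rewrite dvdn1 neq_ltn prime_gt1 ?orbT.
by rewrite factS Euclid_dvdM // negb_or IH ?(ltnW kp) // gtnNdvd.
Qed.

(** For k < p the factor k! is invertible mod p, so the binomial only depends on the residue of x,
    here a natural number. *)
Lemma reduces_qbin x n k : reduces_to x (n%:R : 'F_p) -> (k < p)%N ->
  reduces_to (qbin x k) ('C(n, k)%:R : 'F_p).
Proof.
move=> hx kp; have k0 := natr_fact_neq0 kp.
have -> : 'C(n, k)%:R = (\prod_(i < k) (n%:R - i%:R)) / (k`!)%:R :> 'F_p.
  apply: (mulIf k0); rewrite divfK // -natrM bin_ffact.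
  elim: k {kp k0} => [|k IH]; first by rewrite big_ord0.
  by rewrite big_ord_recr /= -IH natr_ffactSr.
apply: reduces_mul; last by apply: reduces_inv => //; apply: reduces_nat.
by apply: reduces_prod => i _; apply: reduces_sub => //; apply: reduces_nat.
Qed.

End Reduction.

Lemma legendreE (p : nat) (a : int) : prime p -> odd p -> legendre a p = qchar (a%:~R : 'F_p).
Proof.
move=> pp oddp; have oddFp : odd #|'F_p| by rewrite card_Fp.
rewrite /legendre -(intr_eq0_pchar _ (pchar_Fp pp)).
case: eqP => [->|/eqP a0]; first by rewrite qchar0.
have sqE (x : nat) : ((x%:Z ^+ 2 == a %[mod p])%Z) = (x%:R ^+ 2 == a%:~R :> 'F_p).
  by rewrite eqz_mod_dvd -(intr_eq0_pchar _ (pchar_Fp pp)) rmorphB rmorphXn /= subr_eq0.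
case: existsP => [[x]|nex].
  rewrite sqE => /eqP xE; rewrite -xE expr2 qcharM // qchar_sqr //.
  by apply: contraNneq a0 => x0; rewrite -xE x0 expr0n.
case: (qcharP (a%:~R : 'F_p)) => // [/eqP|h1]; first by rewrite qchar_eq0 (negPf a0).
have [y yE] := qchar1_sqrt oddFp h1.
have yp : (y < p)%N by rewrite -[X in (_ < X)%N](Fp_cast pp).
by case: nex; exists (Ordinal yp); rewrite sqE /= yE natr_Zp.
Qed.

(** * The index n and the value of the sum when p = A^2 + 3B^2 *)

(** Take n = (p-1)/4 or (3p-1)/4. The recorded value of 2n later evaluates 4^n = 2^(2n) and (-3)^n =
    (A/B)^(2n). *)
Lemma quarter_index (p : nat) : prime p -> (3 < p)%N ->
  exists n : nat, [/\ (n < p)%N, ((p - 1) %/ 2 <= 2 * n)%N, 4 * n%:R = -1 :> 'F_p &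
    ((p %% 4 = 1)%N /\ (2 * n = (p - 1) %/ 2)%N) \/
    ((p %% 4 = 3)%N /\ (2 * n = p + (p - 1) %/ 2)%N)].
Proof.
move=> pp p3; have oddp : odd p by case/even_prime: pp p3 => // ->.
have p0 : p%:R = 0 :> 'F_p := pchar_Fp_0 pp.
have quarter n m : (4 * n + 1 = m * p)%N -> 4 * n%:R = -1 :> 'F_p.
  move=> e; apply/eqP; rewrite -addr_eq0 -natrM -[1]/(1%:R) -natrD e natrM p0.
  by rewrite mulr0.
have [p4|p4] : (p %% 4 = 1)%N \/ (p %% 4 = 3)%N by move: oddp; clear; lia.
  exists ((p - 1) %/ 4)%N; split; [move: p3; clear; lia | move: p4; clear; lia | | left].
    by apply: (@quarter _ 1%N); move: p4 p3; clear; lia.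
  by split=> //; move: p4; clear; lia.
exists ((3 * p - 1) %/ 4)%N; split; [move: p3; clear; lia | move: p4; clear; lia | | right].
  by apply: (@quarter _ 3%N); move: p4 p3; clear; lia.
by split=> //; move: p4 p3; clear; lia.
Qed.

Lemma qchar3_cases (A A' : int) : A' = A \/ A' = - A -> (3 %| A' + 1)%Z ->
  A' = - qchar (A%:~R : 'F_3) * A.
Proof.
move=> AA h3; have hA' : qchar (A'%:~R : 'F_3) = -1.
  rewrite -[RHS]/((-1) ^+ 1 : int) -(qchar_N1 (isT : prime 3) isT); congr qchar.
  by apply/eqP; rewrite -addr_eq0 -[1]/(1%:~R) -intrD (intr_eq0_pchar _ (pchar_Fp (isT : prime 3))).
case: AA => AE; first by rewrite -AE hA' opprK mul1r.
have -> : A%:~R = -1 * A'%:~R :> 'F_3 by rewrite AE mulN1r rmorphN opprK.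
by rewrite qcharM ?card_Fp // hA' qchar_N1 //= expr1 mulrNN mulr1 mulN1r.
Qed.

Section NormFormValue.
Variables (p n : nat) (A B : int).
Hypotheses (pp : prime p) (p_gt3 : (3 < p)%N) (pE : p%:Z = A ^+ 2 + 3 * B ^+ 2).
Local Notation chi a := (qchar ((a)%:~R : 'F_p)).

Lemma norm_form_cubsum :
  cubsum (1 : 'F_p) = 2 * (- qchar (A%:~R : 'F_3) * A).
Proof.
have oddp : odd p by case/even_prime: pp p_gt3 => // ->.
have oddFp : odd #|'F_p| by rewrite card_Fp.
have p3 : (3 %| #|'F_p|.-1)%N.
  rewrite card_Fp //; have nA := norm_form_ndvd3 pp p_gt3 pE.
  (* As 3 does not divide A, p = A^2 = 1 mod 3. *)
  have [a [e [e2 AE]]] : exists a e : int, e ^+ 2 = 1 /\ A = 3 * a + e.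
    have [h|h] : (A %% 3)%Z = 1 \/ (A %% 3)%Z = 2 by move: nA; clear; lia.
      by exists (A %/ 3)%Z, 1; split; [rewrite expr1n | move: h; clear; lia].
    by exists ((A %/ 3)%Z + 1), (-1); split; [rewrite sqrrN expr1n | move: h; clear; lia].
  have : p%:Z = 3 * (3 * a ^+ 2 + 2 * a * e + B ^+ 2) + e ^+ 2 by rewrite pE AE; ring.
  by rewrite e2; move: p_gt3; clear; lia.
have [z hz] := finField_prim_root 'F_p.
have [A' [B' [fE]]] := cubsum1_norm oddFp p3 hz; rewrite card_Fp // => pE' A'3.
by rewrite fE (qchar3_cases (norm_form_unique pp pE pE') A'3).
Qed.

Let B0 : B%:~R != 0 :> 'F_p.
Proof. by rewrite (intr_eq0_pchar _ (pchar_Fp pp)); case: (norm_form_ndvd pp p_gt3 pE). Qed.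

Let A0 : A%:~R != 0 :> 'F_p.
Proof. by rewrite (intr_eq0_pchar _ (pchar_Fp pp)); case: (norm_form_ndvd pp p_gt3 pE). Qed.

Lemma norm_form_sqrtN3 : (A%:~R / B%:~R) ^+ 2 = -3 :> 'F_p.
Proof.
have : A%:~R ^+ 2 + 3 * B%:~R ^+ 2 = 0 :> 'F_p.
  rewrite -(pchar_Fp_0 pp) -[RHS]/(p%:Z%:~R) pE.
  by rewrite rmorphD rmorphM !rmorphXn.
move/eqP; rewrite addr_eq0 => /eqP e.
by rewrite expr_div_n e mulNr mulfK // expf_neq0.
Qed.

Lemma norm_form_half_power :
  (A%:~R / B%:~R) ^+ ((p - 1) %/ 2)%N = (chi A * chi B)%:~R :> 'F_p.
Proof.
have oddp : odd p by case/even_prime: pp p_gt3 => // ->.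
have oddFp : odd #|'F_p| by rewrite card_Fp.
by rewrite -(qcharV oddFp B%:~R) -qcharM // qcharE // card_Fp // subn1 divn2.
Qed.

Lemma norm_form_N3_half : (-3) ^+ ((p - 1) %/ 2)%N = 1 :> 'F_p.
Proof.
have oddp : odd p by case/even_prime: pp p_gt3 => // ->.
rewrite -norm_form_sqrtN3 -exprM (_ : (2 * _ = #|'F_p|.-1)%N).
  by rewrite expf_card_pred // mulf_neq0 // invr_neq0.
by rewrite card_Fp //; move: oddp p_gt3; clear; lia.
Qed.

Lemma norm_form_value1 : (p %% 4 = 1)%N -> (2 * n = (p - 1) %/ 2)%N ->
  - ((-3) ^+ n * (-3) ^+ ((p - 1) %/ 2)%N * (cubsum (1 : 'F_p))%:~R) =
  ((-1) ^+ ((p - 1) %/ 4)%N * (if (4 %| A - 1)%Z then 1 else -1) * (2 * A))%:~R :> 'F_p.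
Proof.
move=> p4 hn; rewrite norm_form_N3_half mulr1 -norm_form_sqrtN3 -exprM hn.
rewrite norm_form_half_power norm_form_cubsum -intrM -mulrNz.
rewrite -(norm_form_sign1 pp p_gt3 pE p4); congr (_%:~R); ring.
Qed.

(** Here (A/B)^(2n) carries an extra (A/B)^p = A/B, and (A/B) A = -3B trades A for B. *)
Lemma norm_form_value3 : (p %% 4 = 3)%N -> (2 * n = p + (p - 1) %/ 2)%N -> (4 %| B - 1)%Z ->
  - ((-3) ^+ n * (-3) ^+ ((p - 1) %/ 2)%N * (cubsum (1 : 'F_p))%:~R) =
  ((-1) ^+ ((p + 1) %/ 4)%N * (6 * B))%:~R :> 'F_p.
Proof.
move=> p4 hn B4; rewrite norm_form_N3_half mulr1 -norm_form_sqrtN3 -exprM hn exprD.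
have frob (x : 'F_p) : x ^+ p = x by rewrite -{2}(expf_card x) card_Fp.
rewrite frob norm_form_half_power norm_form_cubsum.
have -> : (-1) ^+ ((p + 1) %/ 4)%N = - (chi A * chi B * qchar (A%:~R : 'F_3)).
  by rewrite (norm_form_sign3 pp p_gt3 pE p4 B4) opprK.
rewrite !(intrM, mulrNz) /=.
have e : A%:~R / B%:~R * A%:~R = - 3 * B%:~R :> 'F_p.
  by rewrite -norm_form_sqrtN3 expr2 -!mulrA mulVf // mulr1.
have -> : 2%:~R = 2 :> 'F_p by [].
have -> : 6%:~R = 6 :> 'F_p by [].
move: ((chi A)%:~R : 'F_p) ((chi B)%:~R : 'F_p) ((qchar (A%:~R : 'F_3))%:~R : 'F_p) => u v w.
transitivity (2 * u * v * w * (A%:~R / B%:~R * A%:~R)); first by ring.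
by rewrite e; ring.
Qed.

End NormFormValue.

(** The exponent may be negative, since A may be; the parity of (A-1)/2 is read off from A mod 4. *)
Lemma signz_half (m : nat) (A : int) : odd `|A|%N ->
  (-1) ^ (m%:Z + ((A - 1) %/ 2)%Z) =
  ((-1) ^+ m * (if (4 %| A - 1)%Z then 1 else -1))%:~R :> rat.
Proof.
move=> oA; rewrite expfzDr ?oppr_eq0 ?oner_eq0 // rmorphM rmorphXn rmorphN1 /=.
congr (_ * _); case: ifP => A4.
  have -> : ((A - 1) %/ 2)%Z = 2 * ((A - 1) %/ 4)%Z by move: A4; clear; lia.
  by rewrite -exprz_exp -exprnP sqrrN expr1n exp1rz.
have -> : ((A - 1) %/ 2)%Z = 2 * ((A - 1) %/ 4)%Z + 1 by move: A4 oA; clear; lia.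
by rewrite expfzDr ?oppr_eq0 ?oner_eq0 // -exprz_exp -exprnP sqrrN expr1n exp1rz mul1r.
Qed.

Theorem theorem6p3 (p : nat) (p_prime : prime p) (p_gt3 : (3 < p)%N) :
  let S := \sum_(0 <= k < p) qbin (- (1 / 4)) k ^+ 2 * 4 ^+ k in
  let T := (3 - (-1) ^+ ((p - 1) %/ 2)%N) / 2 * (legendre 2 p)%:~R
           * \sum_(0 <= k < p) qbin (- (1 / 4)) k ^+ 2 * (1 / 4 ^+ k) in
  [/\ qcong p S T,
      (forall A B : int,
         p%:Z = A ^+ 2 + 3 * B ^+ 2 -> p = 1 %[mod 12] ->
         qcong p T
           ((-1) ^ (((p - 1) %/ 4)%N%:Z + ((A - 1) %/ 2)%Z) * (2 * A%:~R))),
      (forall A B : int,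
         p%:Z = A ^+ 2 + 3 * B ^+ 2 -> p = 7 %[mod 12] -> (4 %| B - 1)%Z ->
         qcong p T ((-1) ^+ ((p + 1) %/ 4)%N * (6 * B%:~R)))
    & (p = 2 %[mod 3] -> qcong p T 0)].
Proof.
move=> S T.
have oddp : odd p by case/even_prime: p_prime p_gt3 => // ->.
have oddFp : odd #|'F_p| by rewrite card_Fp.
have nat_neq0 m : (0 < m < p)%N -> m%:R != 0 :> 'F_p.
  by move=> /andP[m0 mp]; rewrite -(dvdn_pcharf (pchar_Fp p_prime)) gtnNdvd.
have F3 : 3 != 0 :> 'F_p by apply: (nat_neq0 3%N).
have F2 : 2 != 0 :> 'F_p by apply: (nat_neq0 2%N); apply: ltnW.
have F4 : 4 != 0 :> 'F_p.
  have -> : 4 = 2 * 2 :> 'F_p by ring.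
  exact: mulf_neq0.
have [n [np hle hn ncase]] := quarter_index p_prime p_gt3.
(* The common residue of S and T. *)
pose s : 'F_p := \sum_(k < n.+1) 'C(n, k)%:R ^+ 2 * 4 ^+ k.
have sE : s = - ((-3) ^+ n * (-3) ^+ ((p - 1) %/ 2)%N * (cubsum (1 : 'F_p))%:~R).
  apply: quarter_sum => //; last exact: natr_fact_neq0.
  by rewrite card_Fp // subn1 divn2.
have red_quarter : reduces_to (- (1 / 4)) (n%:R : 'F_p).
  have -> : n%:R = - (1 / 4) :> 'F_p.
    by apply: (mulfI F4); rewrite hn mulrN mul1r mulfV.
  apply: reduces_opp; apply: reduces_mul => //; first exact: (@reduces_nat p 1).
  by apply: reduces_inv => //; exact: (@reduces_nat p 4).
have red4 k : reduces_to (4 ^+ k) (4 ^+ k : 'F_p).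
  by apply: reduces_exp => //; exact: (@reduces_nat p 4).
have trunc (g : nat -> 'F_p) :
    \sum_(0 <= k < p) 'C(n, k)%:R ^+ 2 * g k = \sum_(k < n.+1) 'C(n, k)%:R ^+ 2 * g k.
  rewrite (@big_cat_nat _ _ _ n.+1) //= big_mkord [X in _ + X]big_nat.
  by rewrite [X in _ + X]big1 ?addr0 // => k /andP[nk _]; rewrite bin_small // expr0n mul0r.
have redS : reduces_to S s.
  rewrite /s -(trunc (fun k => 4 ^+ k)) /S big_nat [\sum_(0 <= k < p) _ in X in reduces_to _ X]big_nat.
  apply: reduces_sum => // k kp; apply: reduces_mul => //; apply: reduces_exp => //.
  exact: reduces_qbin.
(* 4^n = 2^(2n) is chi(2) by Euler's criterion if p = 1 mod 4, and 2^p chi(2) = 2 chi(2) if p = 3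
   mod 4; the fraction encodes this 1 or 2. *)
have four_n : 4 ^+ n = (3 - (-1) ^+ ((p - 1) %/ 2)%N) / 2 * (legendre 2 p)%:~R :> 'F_p.
  have -> : 4 = 2 ^+ 2 :> 'F_p by ring.
  rewrite -exprM legendreE // qcharE // card_Fp // -divn2 -subn1 -signr_odd.
  case: ncase => [[p4 ->]|[p4 ->]].
    rewrite (_ : odd _ = false); last by move: p4; clear; lia.
    by rewrite (_ : 3 - 1 = 2) ?mulfV ?mul1r //; ring.
  rewrite (_ : odd _ = true); last by move: p4; clear; lia.
  have -> : 3 - (-1) ^+ true = 2 * 2 :> 'F_p by ring.
  rewrite mulfK // exprD; congr (_ * _).
  by have := expf_card (2 : 'F_p); rewrite card_Fp.
have redT : reduces_to T s.
  have -> : s = (3 - (-1) ^+ ((p - 1) %/ 2)%N) / 2 * (legendre 2 p)%:~R *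
                 \sum_(0 <= k < p) 'C(n, k)%:R ^+ 2 * (1 / 4 ^+ k).
    (* Reversing k to n - k turns 4^k into 4^n / 4^k. *)
    rewrite -four_n trunc mulr_sumr /s (reindex_inj rev_ord_inj) /=.
    apply: eq_bigr => -[k /= lk] _; have kn : (k <= n)%N by [].
    rewrite subSS bin_sub // mulrCA div1r; congr (_ * _).
    by rewrite -{2}(subnK kn) exprD mulfK // expf_neq0.
  apply: reduces_mul => //.
    apply: reduces_mul => //; last exact: reduces_int.
    apply: reduces_mul => //; last by apply: reduces_inv => //; exact: (@reduces_nat p 2).
    apply: reduces_sub => //; first exact: (@reduces_nat p 3).
    by apply: reduces_exp => //; exact: (@reduces_int p (-1)).
  rewrite big_nat [\sum_(0 <= k < p) _ in X in reduces_to _ X]big_nat.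
  apply: reduces_sum => // k kp; apply: reduces_mul => //.
    by apply: reduces_exp => //; exact: reduces_qbin.
  apply: reduces_mul => //; first exact: (@reduces_nat p 1).
  by apply: reduces_inv => //; rewrite expf_neq0.
split.
- exact: reduces_qcong redS redT.
- move=> A B pE p12; have p4 : (p %% 4 = 1)%N by move: p12; clear; lia.
  have n2 : (2 * n = (p - 1) %/ 2)%N by case: ncase => [[]|[]] //; rewrite p4.
  apply: reduces_qcong redT _ => //.
  rewrite sE (norm_form_value1 p_prime p_gt3 pE p4 n2).
  rewrite signz_half; last exact: norm_form_oddA pE p4.
  rewrite -[2 * A%:~R](intrM _ 2) -intrM.
  exact: reduces_int.
- move=> A B pE p12 B4; have p4 : (p %% 4 = 3)%N by move: p12; clear; lia.
  have n2 : (2 * n = p + (p - 1) %/ 2)%N by case: ncase => [[]|[]] //; rewrite p4.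
  apply: reduces_qcong redT _ => //.
  rewrite sE (norm_form_value3 p_prime p_gt3 pE p4 n2 B4).
  have -> : (-1) ^+ ((p + 1) %/ 4)%N * (6 * B%:~R) =
      ((-1) ^+ ((p + 1) %/ 4)%N * (6 * B))%:~R :> rat.
    by rewrite !intrM rmorphXn rmorphN1.
  exact: reduces_int.
- move=> p3; apply: reduces_qcong redT _ => //.
  rewrite sE cubsum1_eq0 // ?card_Fp // mulr0 oppr0.
  exact: (@reduces_int p 0).
Qed.
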